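(* Let $M$ be a connected Riemannian manifold, let $U\subset M$ be a convex set, and let $Y$ be a $C^1$ vector field on $U$ with $\|Y\|\le\epsilon_0<r_{\rm inj}(U)$ at each point of $U$. Let $\Psi_Y(p)=\exp_p(Y_p)$ and suppose $U$ is preserved by $\Psi_Y$. Let $p_0\in U$, and for $n>0$ let $p_n=\Psi_Y^n(p_0)$. Then for all $n\ge1$ $$d(p_{n+1},p_n)\le\Big(\sup_{p\in U}\|(\nabla Y+I)_p\|\Big)\,d(p_n,p_{n-1}).$$
   Context: $d$ is the Riemannian distance on $M$ (not assumed complete). $\nabla$ is the Levi-Civita connection, $\nabla Y$ at $p$ is the endomorphism $v\mapsto\nabla_vY$ of $T_pM$, $I$ is the identity, and norms of endomorphisms are operator norms. $U$ is convex if for all $p,q\in U$ there is a unique minimal geodesic segment in $M$ from $p$ to $q$ and it lies entirely in $U$. $r_{\rm inj}(p)$ is the supremum of $\rho$ such that $\exp_p$ is defined on $B_\rho(0)\subset T_pM$ and is a diffeomorphism from it onto its image; $r_{\rm inj}(U)=\inf_{p\in U}r_{\rm inj}(p)$. *)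

(* Defs.v *)
From HB Require Import structures.
From mathcomp Require Import all_boot all_order all_algebra.
From mathcomp Require Import all_classical all_reals all_analysis.
From mathcomp Require Import ring.

Set Implicit Arguments.
Unset Strict Implicit.
Unset Printing Implicit Defensive.
Import Order.TTheory GRing.Theory Num.Theory.
Import numFieldNormedType.Exports.
Local Open Scope classical_set_scope.
Local Open Scope ring_scope.

(* [A] is meant to be open and [V] finite-dimensional: both notions below only
   look at [f] near the points of [A]. *)
Fixpoint Ck (R : realType) (V W : normedModType R) (k : nat)
    (A : set V) (f : V -> W) : Prop :=
  match k with
  | 0 => {in A, continuous f}
  | k'.+1 => {in A, forall x, differentiable f x} /\
             forall v : V, Ck k' A ('D_v f)
  end.

Definition smooth (R : realType) (V W : normedModType R)
    (A : set V) (f : V -> W) : Prop := forall k, Ck k A f.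

(* A smooth manifold of dimension n, presented by an atlas in which a chart
   around each point p has been selected: [chart p] maps [chart_dom p]
   homeomorphically onto an open subset of R^n, with inverse [param p].  Any
   smooth structure is generated by such an atlas.  Outside [chart_dom p] (resp.
   outside its image) the values of [chart p] (resp. [param p]) are junk. *)
Record smoothManifold (R : realType) (n : nat) := SmoothManifold {
  carrier :> topologicalType;
  carrier_hausdorff : hausdorff_space carrier;
  carrier_second_countable : @second_countable carrier;
  chart_dom : carrier -> set carrier;
  chart : carrier -> carrier -> 'rV[R]_n;
  param : carrier -> 'rV[R]_n -> carrier;
  chart_dom_center : forall p, chart_dom p p;
  chart_dom_open : forall p, open (chart_dom p);
  chart_img_open : forall p, open (chart p @` chart_dom p);
  chartK : forall p, {in chart_dom p, cancel (chart p) (param p)};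
  chart_continuous : forall p, {in chart_dom p, continuous (chart p)};
  param_continuous : forall p, {in chart p @` chart_dom p, continuous (param p)};
  transition_smooth : forall p q,
    smooth (chart p @` (chart_dom p `&` chart_dom q)) (chart q \o param p)
}.

(* The tangent space T_qM is identified with 'rV[R]_n by means of the
   coordinates of the chart selected at q.  If w is the row of components of a
   tangent vector at q in the chart at p, then [coord_change p p' q w] is the
   row of its components in the chart at p'.  In particular, [coord_change p q q]
   maps components in the chart at p to elements of T_qM, and [coord_change q p q]
   maps elements of T_qM to components in the chart at p. *)
Definition coord_change (R : realType) (n : nat) (M : smoothManifold R n)
    (p p' q : M) : 'rV[R]_n -> 'rV[R]_n :=
  'd (chart p' \o param p) (chart p q).

(* [g q] is the Gram matrix of an inner product on T_qM. *)
Definition tinner (R : realType) (n : nat) (M : Type) (g : M -> 'M[R]_n)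
    (q : M) (u v : 'rV[R]_n) : R := (u *m g q *m v^T) 0 0.

(* The coefficients g_ij, as functions on the image of the chart at p. *)
Definition gram_of (R : realType) (n : nat) (M : smoothManifold R n)
    (g : M -> 'M[R]_n) (p : M) (x : 'rV[R]_n) : 'M[R]_n :=
  \matrix_(i < n, j < n)
    let q := param p x in
    tinner g q (coord_change p q q (delta_mx 0 i))
               (coord_change p q q (delta_mx 0 j)).

Record riemannianManifold (R : realType) (n : nat) := RiemannianManifold {
  manifold :> smoothManifold R n;
  gmetric : manifold -> 'M[R]_n;
  gmetric_sym : forall q, (gmetric q)^T = gmetric q;
  gmetric_posdef : forall q (v : 'rV[R]_n), v != 0 -> 0 < tinner gmetric q v v;
  gmetric_smooth : forall p,
    smooth (chart p @` chart_dom p) (gram_of gmetric p)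
}.

Section Riemannian.
Context (R : realType) (n : nat) (M : riemannianManifold R n).
Implicit Types (p q : M) (x u v w : 'rV[R]_n) (c : R -> M) (U V : set M).

Definition tnorm p v : R := Num.sqrt (tinner (@gmetric R n M) p v v).

Definition gram p x : 'M[R]_n := gram_of (@gmetric R n M) p x.

Lemma tinnerC q u v : tinner (@gmetric R n M) q u v = tinner (@gmetric R n M) q v u.
Proof.
rewrite /tinner -[in LHS](trmxK (u *m _ *m _)) [LHS]mxE.
by rewrite !trmx_mul trmxK gmetric_sym mulmxA.
Qed.

Lemma gramC p x i j : gram p x i j = gram p x j i.
Proof. by rewrite !mxE /= tinnerC. Qed.

Lemma coord_changeV p q : chart_dom p q ->
  forall v, coord_change q p q (coord_change p q q v) = v.
Proof.
move=> pq v; rewrite /coord_change.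
have Dpq : differentiable (chart q \o param p) (chart p q).
  have [+ _] := transition_smooth p q 1; apply.
  by rewrite inE; exists q => //; split => //; exact: chart_dom_center.
have Dqp : differentiable (chart p \o param q) (chart q q).
  have [+ _] := transition_smooth q p 1; apply.
  by rewrite inE; exists q => //; split => //; exact: chart_dom_center.
have Ep : param p (chart p q) = q by apply: chartK; rewrite inE.
have Eqp : 'd (chart p \o param q) (chart q q) = 'd (chart p \o param q) ((chart q \o param p) (chart p q)).
  by rewrite /= Ep.
have Dqp' : differentiable (chart p \o param q) ((chart q \o param p) (chart p q)).
  by rewrite /= Ep.
have := diff_comp Dpq Dqp' => /(congr1 (fun f => f v)) /=.
rewrite Ep => <-; rewrite -deriveE; last exact: differentiable_comp.
rewrite -[RHS](derive_id (chart p q) v); apply: near_eq_derive.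
have img : nbhs (chart p q) (chart p @` chart_dom p).
  by apply: open_nbhs_nbhs; split; [exact: chart_img_open | exists q].
have par : nbhs (chart p q) (param p @^-1` chart_dom q).
  apply: param_continuous; first by rewrite inE; exists q.
  by rewrite Ep; apply: open_nbhs_nbhs; split; [exact: chart_dom_open|exact: chart_dom_center].
near=> y.
have [r rp ry] : (chart p @` chart_dom p) y by near: y.
have yq : chart_dom q (param p y) by near: y.
have e1 : param q (chart q (param p y)) = param p y by apply: chartK; rewrite inE.
have e2 : param p (chart p r) = r by apply: chartK; rewrite inE.
by rewrite /= e1 -ry e2.
Unshelve. all: by end_near. Qed.

Lemma gram_unit p x : (chart p @` chart_dom p) x -> gram p x \in unitmx.
Proof.
move=> [q pq <-]; have Ep : param p (chart p q) = q by apply: chartK; rewrite inE.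
rewrite -row_free_unit -kermx_eq0; apply/eqP/row_matrixP => i.
rewrite row0; set w := row i _.
have wG : w *m gram p (chart p q) = 0 by apply/sub_kermxP; exact: row_sub.
pose f := 'd (chart q \o param p) (chart p q).
have fw : f w = \sum_k w 0 k *: f (delta_mx 0 k).
  by rewrite [in LHS](row_sum_delta w) linear_sum; apply: eq_bigr => k _; rewrite linearZ.
have : tinner (@gmetric R n M) q (f w) (f w) = 0.
  transitivity ((w *m gram p (chart p q) *m w^T) 0 0); last by rewrite wG mul0mx mxE.
  rewrite {1}/tinner fw mulmx_suml mulmx_suml summxE mxE.
  rewrite (eq_bigr (fun k => \sum_l w 0 k * w 0 l * gram p (chart p q) k l)); last first.
    move=> k _; rewrite linear_sum mulmx_sumr summxE; apply: eq_bigr => l _.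
    rewrite !linearZ /= -!scalemxAl [LHS]mxE [X in _ * X]mxE.
    by rewrite [gram _ _ _ _]mxE Ep -/f mulrA (mulrC (w 0 l)).
  rewrite exchange_big; apply: eq_bigr => l _; rewrite [w^T _ _]mxE [(w *m _) _ _]mxE mulr_suml.
  by apply: eq_bigr => k _; rewrite mulrAC.
have [fw0 _|fw0 E] := eqVneq (f w) 0; last first.
  by have := @gmetric_posdef _ _ M q _ fw0; rewrite E ltxx.
have := coord_changeV pq w.
have -> : coord_change p q q w = 0 by exact: fw0.
by rewrite /coord_change linear0.
Qed.

(* The Levi-Civita connection, through its Christoffel symbols Gamma^k_ij in the
   chart at p, at the point with coordinates x. *)
Definition christoffel p x (k i j : 'I_n) : R :=
  2^-1 * \sum_(l < n) invmx (gram p x) k l *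
    ('D_(delta_mx 0 i) (fun y => gram p y j l) x
     + 'D_(delta_mx 0 j) (fun y => gram p y i l) x
     - 'D_(delta_mx 0 l) (fun y => gram p y i j) x).

(* The two properties characterizing the Levi-Civita connection: it is
   torsion-free and compatible with the metric. *)
Lemma christoffelC p x k i j : christoffel p x k i j = christoffel p x k j i.
Proof.
have E : (fun y => gram p y i j) = (fun y => gram p y j i).
  by apply/funext => y; exact: gramC.
rewrite /christoffel E; congr (_ * _); apply: eq_bigr => l _.
by rewrite (addrC ('D_(delta_mx 0 i) _ _)).
Qed.

Lemma christoffel_metric p x i j k : (chart p @` chart_dom p) x ->
  'D_(delta_mx 0 k) (fun y => gram p y i j) x =
  \sum_(l < n) (christoffel p x l k i * gram p x l j
                + christoffel p x l k j * gram p x i l).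
Proof.
move=> /gram_unit gU.
have key (F : 'I_n -> R) a : \sum_l (2^-1 * \sum_m invmx (gram p x) l m * F m) * gram p x l a = 2^-1 * F a.
  transitivity (2^-1 * \sum_m (\sum_l gram p x a l * invmx (gram p x) l m) * F m).
    rewrite (eq_bigr (fun l => 2^-1 * \sum_m (gram p x a l * invmx (gram p x) l m * F m))).
      rewrite -mulr_sumr exchange_big /=; congr (_ * _).
      by apply: eq_bigr => m _; rewrite mulr_suml.
    move=> l _; rewrite -mulrA; congr (_ * _); rewrite mulr_suml; apply: eq_bigr => m _.
    by rewrite (gramC p x a l); ring.
  congr (_ * _); rewrite (bigD1 a) //= [X in _ + X]big1 ?addr0.
    have /matrixP/(_ a a) := mulmxV gU; rewrite !mxE eqxx => ->; exact: mul1r.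
  move=> m ma; have /matrixP/(_ a m) := mulmxV gU; rewrite !mxE eq_sym (negbTE ma) => ->.
  exact: mul0r.
have S a b m : 'D_(delta_mx 0 m) (fun y => gram p y a b) x =
    'D_(delta_mx 0 m) (fun y => gram p y b a) x.
  have -> // : (fun y => gram p y a b) = (fun y => gram p y b a).
  by apply/funext => y; exact: gramC.
rewrite big_split /= !key (eq_bigr _ (fun l _ => congr1 _ (gramC p x i l))) key.
rewrite (S j i k) (S k i j) (S k j i) (S j k i); set A := 'D_ _ _ _. 
by field.
Qed.
Definition christoffel_form p x u v : 'rV[R]_n :=
  \row_(k < n) \sum_(i < n) \sum_(j < n) christoffel p x k i j * u 0 i * v 0 j.

(* A vector field is a map Y with Y q in T_qM; [field_rep Y p] gives its
   components in the chart at p as functions of the coordinates. *)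
Definition field_rep (Y : M -> 'rV[R]_n) p x : 'rV[R]_n :=
  let q := param p x in coord_change q p q (Y q).

(* A field on an arbitrary set U is C^1 if it is the restriction of a C^1 field
   on an open neighbourhood of U; values of Y off that neighbourhood are junk. *)
Definition C1_field_on U (Y : M -> 'rV[R]_n) : Prop :=
  exists V, [/\ open V, U `<=` V &
    forall p, Ck 1 (chart p @` (chart_dom p `&` V)) (field_rep Y p)].

(* The covariant derivative of Y at p in the direction v of T_pM. *)
Definition nabla (Y : M -> 'rV[R]_n) p v : 'rV[R]_n :=
  'D_v (field_rep Y p) (chart p p) + christoffel_form p (chart p p) v (Y p).

Definition opnorm p (A : 'rV[R]_n -> 'rV[R]_n) : \bar R :=
  ereal_sup [set (tnorm p (A v))%:E | v in [set v | tnorm p v <= 1]].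

(* The velocity of c at time t, an element of the tangent space at c t. *)
Definition velocity c (t : R) : 'rV[R]_n := derive1 (chart (c t) \o c) t.

(* C^1 curves [0, 1] -> M, as restrictions of C^1 curves on an open interval. *)
Definition C1_segment c : Prop := exists2 e : R, 0 < e &
  {in `]- e, 1 + e[, forall t, {for t, continuous c} /\
    forall p, chart_dom p (c t) ->
      derivable (chart p \o c) t 1 /\ {for t, continuous (derive1 (chart p \o c))}}.

Definition curve_length c : \bar R :=
  (\int[lebesgue_measure]_(t in `[0%R, 1%R]) (tnorm (c t) (velocity c t))%:E)%E.

(* Piecewise C^1 paths from p to q, as chains of C^1 segments (the end point q
   comes first among the arguments). *)
Fixpoint pw_C1_path (q : M) (p : M) (s : seq (R -> M)) : Prop :=
  match s with
  | [::] => p = q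
  | c :: s' => [/\ C1_segment c, c 0 = p & pw_C1_path q (c 1) s']
  end.

Definition path_length (s : seq (R -> M)) : \bar R :=
  (\sum_(c <- s) curve_length c)%E.

Definition rdist p q : \bar R := ereal_inf [set path_length s | s in pw_C1_path q p].

(* Affinely parametrized geodesics [0, 1] -> M. *)
Definition geodesic_segment c : Prop := exists2 e : R, 0 < e &
  {in `]- e, 1 + e[, forall t, {for t, continuous c} /\
    forall p, chart_dom p (c t) ->
      let x := chart p \o c in
      let x' := derive1 x in
      [/\ derivable x t 1, derivable x' t 1 &
          derive1 x' t + christoffel_form p (x t) (x' t) (x' t) = 0]}.

Definition geodesic_from p v c : Prop :=
  [/\ geodesic_segment c, c 0 = p & velocity c 0 = v].

Definition exp_defined p v : Prop := exists c, geodesic_from p v c.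

(* Outside the domain [exp_defined p] of exp_p, the value is the junk value p. *)
Definition Exp p v : M :=
  xget p [set q | exists2 c, geodesic_from p v c & c 1 = q].

Definition minimal_geodesic p q c : Prop :=
  [/\ geodesic_segment c, c 0 = p, c 1 = q & curve_length c = rdist p q].

Definition geodesically_convex U : Prop :=
  forall p q, U p -> U q -> exists c,
    [/\ minimal_geodesic p q c,
        forall c', minimal_geodesic p q c' -> {in `[0, 1], c' =1 c} &
        {in `[0, 1], forall t, U (c t)}].

(* Diffeomorphism from an open subset A of a tangent space onto an open subset
   of M. *)
Definition diffeo_onto_image (A : set 'rV[R]_n) (f : 'rV[R]_n -> M) : Prop :=
  [/\ {in A, continuous f},
      forall p, smooth (A `&` f @^-1` chart_dom p) (chart p \o f),
      open (f @` A) &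
      exists2 h : M -> 'rV[R]_n, {in A, cancel f h} &
        forall p, smooth (chart p @` (chart_dom p `&` f @` A)) (h \o param p)].

Definition tball p (rho : R) : set 'rV[R]_n := [set v | tnorm p v < rho].

Definition inj_radius p : \bar R :=
  ereal_sup [set rho%:E | rho in [set rho : R |
    [/\ 0 < rho, tball p rho `<=` exp_defined p &
        diffeo_onto_image (tball p rho) (Exp p)]]].

Definition inj_radius_set U : \bar R := ereal_inf [set inj_radius p | p in U].

Definition Psi (Y : M -> 'rV[R]_n) p : M := Exp p (Y p).

End Riemannian.

(* Main.v *)
Require Import Defs.
From HB Require Import structures.
From mathcomp Require Import all_boot all_order all_algebra.
From mathcomp Require Import all_classical all_reals all_analysis.
From mathcomp Require Import ring lra.

Set Implicit Arguments.
Unset Strict Implicit.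
Unset Printing Implicit Defensive.
Import Order.TTheory GRing.Theory Num.Theory.
Import numFieldNormedType.Exports.
Local Open Scope classical_set_scope.
Local Open Scope ring_scope.

(** Write [p], [q = Psi Y p] and [Psi Y q] for three consecutive iterates, and
    let [c] be the geodesic with [c 0 = p] and initial velocity [Y p], so that
    [c 1 = q].  The field
      X t = Y (c t) - (1 - t) c'(t)
    along [c] vanishes at 0 and equals [Y q] at 1.  As [c] is a geodesic, its
    covariant derivative is (nabla Y + I) c'(t), whose norm is at most k |Y p|,
    with k the supremum of the operator norms and |Y p| the constant speed of
    [c]; hence |Y q| <= k |Y p| ([field_growth]).  Indeed metric compatibility
    gives the derivative 2 <X, DX> of |X|^2, and the bound on |X| follows from
    Cauchy-Schwarz and the mean value theorem applied to sqrt (|X|^2 + e^2),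
    which is differentiable even where X vanishes ([sqrt_growth]).

    It remains to compare |Y p| and |Y q| with distances, and to see that [c]
    stays in [U], where the operator norms are controlled.  The distance from
    [Psi Y q] to [q] is at most the length |Y q| of the geodesic defining
    [Psi Y q] ([rdist_reverse_le]; the curve has to be run backwards).  For the
    pair [q], [p] equality is needed.  Convexity provides a minimal geodesic
    inside [U]; reversed, it starts at [p] with a velocity [w] such that
    |w| = d (q, p) <= |Y p| and exp_p w = q = exp_p (Y p).  Both vectors lie in a
    ball on which exp_p is injective, so [w = Y p].  Thus the minimal geodesic
    is [c] itself, and d (q, p) = |Y p|.

    The equality exp_p w = q rests on the uniqueness of geodesics with given
    initial position and velocity ([geodesic_unique], [Exp_geodesic]).  The
    geodesic equation in a chart is a first-order system whose right-hand side
    is locally Lipschitz: the Christoffel symbols are obtained from C^1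
    functions by sums, products and the inversion of the Gram matrix, all of
    which preserve this property.  A Gronwall estimate then makes two
    solutions agree for a short time after they meet with equal velocities
    ([ode_unique]), and a continuation argument on the unit interval makes
    this global ([itv_induction]). *)

(** * Derivatives along curves, and locally Lipschitz functions *)

Section Calculus.
Context (R : realType).

Lemma is_derive_curve (V W : normedModType R) (f : V -> W) (c : R -> V) (t : R)
    (v : V) : is_derive t 1 c v -> differentiable f (c t) ->
  is_derive t 1 (f \o c) ('D_v f (c t)).
Proof.
move=> [dc <-] df; have /derivable1_diffP dc' := dc.
apply: DeriveDef; first exact/derivable1_diffP/differentiable_comp.
rewrite [LHS]deriveE; last exact: differentiable_comp.
rewrite (diff_comp dc' df) /=; rewrite [RHS]deriveE//; congr ('d f (c t) _).
by rewrite deriveE.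
Qed.

Lemma derive_coord (V : normedModType R) m n (f : V -> 'M[R]_(m, n)) x v i j :
  derivable f x v -> 'D_v (fun y => f y i j) x = ('D_v f x) i j.
Proof. by move=> df; rewrite (derive_mx df) mxE. Qed.

Lemma is_derive_coord (V : normedModType R) m n (f : V -> 'M[R]_(m, n)) x v (df : 'M[R]_(m, n))
    i j : is_derive x v f df -> is_derive x v (fun y => f y i j) (df i j).
Proof.
move=> [d <-]; apply: DeriveDef; last exact: derive_coord.
by have /derivable_mxP := d.
Qed.

Lemma is_derive_coordP (V : normedModType R) m n (f : V -> 'M[R]_(m, n)) x v
    (df : 'M[R]_(m, n)) :
  (forall i j, is_derive x v (fun y => f y i j) (df i j)) -> is_derive x v f df.
Proof.
move=> H; have d : derivable f x v by apply/derivable_mxP => i j; apply: ex_derive.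
apply: DeriveDef => //; apply/matrixP => i j.
by rewrite (derive_mx d) mxE derive_val.
Qed.

Lemma is_derive_continuous (V : normedModType R) (f : R -> V) (t : R) (df : V) :
  is_derive t 1 f df -> {for t, continuous f}.
Proof.
by move=> [d _]; apply: differentiable_continuous; apply/derivable1_diffP; exact: d.
Qed.

Lemma is_derive_mul (f g : R -> R) (t f' g' : R) :
  is_derive t 1 f f' -> is_derive t 1 g g' ->
  is_derive t 1 (fun s => f s * g s) (f' * g t + f t * g').
Proof.
move=> df dg; apply: (is_derive_eq (is_deriveM df dg)).
by rewrite addrC /GRing.scale /= [g t * _]mulrC.
Qed.

Lemma derive_row_sum n (W : normedModType R) (f : 'rV[R]_n -> W) x v :
  differentiable f x ->
  'D_v f x = \sum_(i < n) v 0 i *: 'D_(delta_mx 0 i) f x.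
Proof.
move=> df; rewrite deriveE// [in LHS](row_sum_delta v) linear_sum.
by apply: eq_bigr => i _; rewrite linearZ deriveE.
Qed.

Lemma ler_coord_norm m n (A : 'M[R]_(m, n)) i j : `|A i j| <= `|A|.
Proof.
by rewrite [leRHS]/Num.Def.normr/= mx_normrE (le_bigmax _ (fun k => `|A k.1 k.2|) (i, j)).
Qed.

End Calculus.

Section LocallyLipschitz.
Context (R : realType).

(** A bound for all pairs of points near [x], as opposed to the pairs [(x, y)]:
    this is the form that a Gronwall estimate uses. *)
Definition loclip (V : normedModType R) (f : V -> R) (x : V) :=
  exists L, exists2 A, nbhs x A &
    forall y z, A y -> A z -> `|f y - f z| <= L * `|y - z|.

Section Closure.
Context (V : normedModType R).
Implicit Types (f g : V -> R) (x : V).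

Lemma loclipW f x : loclip f x -> exists2 L, 0 <= L & exists2 A, nbhs x A &
  forall y z, A y -> A z -> `|f y - f z| <= L * `|y - z|.
Proof.
move=> [L [A xA H]]; exists `|L| => //; exists A => // y z Ay Az.
by apply: le_trans (H _ _ Ay Az) _; rewrite ler_wpM2r// ler_norm.
Qed.

Lemma loclip_bounded f x : loclip f x ->
  exists2 B, 0 <= B & \forall y \near x, `|f y| <= B.
Proof.
move=> /loclipW[L L0 [A xA H]]; exists (`|f x| + L) => //; first by rewrite addr_ge0.
have xB : nbhs x (ball x 1) by exact: nbhsx_ballx.
near=> y; have Ay : A y by near: y.
have Ax : A x by exact: nbhs_singleton.
have xy : ball x 1 y by near: y.
rewrite -[f y](subrK (f x)) addrC (le_trans (ler_normD _ _))// lerD2l.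
apply: le_trans (H _ _ Ay Ax) _; rewrite -[leRHS]mulr1; apply: ler_wpM2l => //.
Unshelve. all: by end_near. Qed.

Lemma loclip_cst (a : R) x : loclip (fun=> a) x.
Proof. by exists 0, setT => [|y z _ _]; [exact: filterT|rewrite subrr normr0 mul0r]. Qed.

Lemma loclipD f g x : loclip f x -> loclip g x -> loclip (fun y => f y + g y) x.
Proof.
move=> [L [A xA HA]] [K [B xB HB]]; exists (L + K), (A `&` B); first exact: filterI.
move=> y z [Ay By] [Az Bz].
rewrite opprD addrACA mulrDl (le_trans (ler_normD _ _))// lerD//.
  exact: HA.
exact: HB.
Qed.

Lemma loclipM f g x : loclip f x -> loclip g x -> loclip (fun y => f y * g y) x.
Proof.
move=> lf lg.
have [a a0 fa] := loclip_bounded lf; have [b b0 gb] := loclip_bounded lg.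
have [L L0 [A xA HA]] := loclipW lf; have [K K0 [B xB HB]] := loclipW lg.
exists (a * K + b * L), (A `&` B `&` [set y | `|f y| <= a] `&` [set y | `|g y| <= b]).
  by do 3 (apply: filterI => //).
move=> y z [[[Ay By] fy] gy] [[[Az Bz] fz] gz].
have -> : f y * g y - f z * g z = f y * (g y - g z) + g z * (f y - f z) by ring.
rewrite (le_trans (ler_normD _ _))// !normrM mulrDl -!mulrA lerD// ler_pM//.
  exact: HB.
exact: HA.
Qed.

Lemma loclip_continuous f x : loclip f x -> {for x, continuous f}.
Proof.
move=> /loclipW[L L0 [A xA H]]; apply/cvgrPdist_lt => e e0.
have Ax : A x by exact: nbhs_singleton.
have xB : nbhs x (ball x (e / (L + 1))).
  by apply: nbhsx_ballx; rewrite divr_gt0// ltr_wpDl.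
near=> y; have Ay : A y by near: y.
have : ball x (e / (L + 1)) y by near: y.
rewrite -ball_normE /= => xy; apply: le_lt_trans (H _ _ Ax Ay) _.
rewrite (@le_lt_trans _ _ ((L + 1) * `|x - y|)) //.
  by rewrite ler_wpM2r// lerDl.
by rewrite mulrC -ltr_pdivlMr// ltr_wpDl.
Unshelve. all: by end_near. Qed.

(** 1/f y - 1/f z = (f z - f y) / (f y f z), and near [x] the values of |f| stay
    above the half of |f x|. *)
Lemma loclipV f x : f x != 0 -> loclip f x -> loclip (fun y => (f y)^-1) x.
Proof.
move=> fx0 lf; have [L L0 [A xA HA]] := loclipW lf.
pose b := `|f x| / 2.
have b0 : 0 < b by rewrite divr_gt0// normr_gt0.
exists (L / (b * b)), (A `&` [set y | b < `|f y|]).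
  apply: filterI => //.
  have cf : {for x, continuous (fun y => `|f y|)}.
    by apply: continuous_comp; [exact: loclip_continuous|exact: norm_continuous].
  have : \forall r \near `|f x|, b < r.
    by apply: lt_nbhsr; rewrite /b; have := fx0; rewrite -normr_gt0; lra.
  exact: cf.
move=> y z [Ay by_] [Az bz].
have fy0 : f y != 0 by rewrite -normr_gt0 (lt_trans b0).
have fz0 : f z != 0 by rewrite -normr_gt0 (lt_trans b0).
have -> : (f y)^-1 - (f z)^-1 = (f z - f y) / (f y * f z) by field; rewrite fy0 fz0.
rewrite normrM distrC normfV normrM mulrAC ler_pM// ?invr_ge0 ?mulr_ge0//.
  exact: HA.
rewrite lef_pV2 ?posrE ?mulr_gt0 ?normr_gt0//.
by rewrite ler_pM// ltW.
Qed.

Lemma loclip_sum (I : Type) (r : seq I) (P : pred I) (F : I -> V -> R) x :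
  (forall i, P i -> loclip (F i) x) -> loclip (fun y => \sum_(i <- r | P i) F i y) x.
Proof.
move=> H; elim: r => [|i r IH].
  by under eq_fun do rewrite big_nil; exact: loclip_cst.
under eq_fun do rewrite big_cons; case Pi: (P i) => //.
exact/loclipD/IH/H.
Qed.

Lemma loclip_prod (I : Type) (r : seq I) (P : pred I) (F : I -> V -> R) x :
  (forall i, P i -> loclip (F i) x) -> loclip (fun y => \prod_(i <- r | P i) F i y) x.
Proof.
move=> H; elim: r => [|i r IH].
  by under eq_fun do rewrite big_nil; exact: loclip_cst.
under eq_fun do rewrite big_cons; case Pi: (P i) => //.
exact/loclipM/IH/H.
Qed.

Lemma loclip_det n (G : V -> 'M[R]_n) x :
  (forall i j, loclip (fun y => G y i j) x) -> loclip (fun y => \det (G y)) x.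
Proof.
move=> H; apply: loclip_sum => s _; apply: loclipM; first exact: loclip_cst.
by apply: loclip_prod => i _; exact: H.
Qed.

Lemma loclip_cofactor n (G : V -> 'M[R]_n) i j x :
  (forall i j, loclip (fun y => G y i j) x) -> loclip (fun y => cofactor (G y) i j) x.
Proof.
move=> H; apply: loclipM; first exact: loclip_cst.
by apply: loclip_det => k l; under eq_fun do rewrite !mxE; exact: H.
Qed.

(** By Cramer's rule, the entries of the inverse are cofactors divided by the
    determinant.  Invertibility is asked on a neighbourhood since [invmx] is
    the identity on singular matrices. *)
Lemma loclip_invmx n (G : V -> 'M[R]_n) i j x :
  (\forall y \near x, G y \in unitmx) ->
  (forall i j, loclip (fun y => G y i j) x) ->
  loclip (fun y => invmx (G y) i j) x.
Proof.
move=> Gu H.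
have : loclip (fun y => (\det (G y))^-1 * cofactor (G y) j i) x.
  apply: loclipM; last exact: loclip_cofactor.
  apply: loclipV; last exact: loclip_det.
  by have := nbhs_singleton Gu; rewrite unitmxE unitfE.
move=> [L [A xA HA]]; exists L, (A `&` [set y | G y \in unitmx]); first exact: filterI.
have E y : G y \in unitmx -> invmx (G y) i j = (\det (G y))^-1 * cofactor (G y) j i.
  by move=> yu; rewrite /invmx yu !mxE.
by move=> y z [Ay Gy] [Az Gz]; rewrite !E//; exact: HA.
Qed.

End Closure.

Lemma loclip_comp (V W : normedModType R) (h : V -> W) (f : W -> R) x :
  (forall y z, `|h y - h z| <= `|y - z|) -> {for x, continuous h} ->
  loclip f (h x) -> loclip (f \o h) x.
Proof.
move=> hl ch /loclipW[L L0 [A xA H]]; exists L, (h @^-1` A); first exact: ch.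
by move=> y z Ay Az; apply: le_trans (H _ _ Ay Az) _; rewrite ler_wpM2l.
Qed.

(** The mean value theorem on segments of a small ball, where the finitely many
    partial derivatives are bounded by continuity. *)
Lemma C1_loclip n k l (A : set 'rV[R]_n) (F : 'rV[R]_n -> 'M[R]_(k, l)) x a b :
  open A -> A x -> Ck 1 A F -> loclip (fun y => F y a b) x.
Proof.
move=> oA Ax [dfA cfA].
pose B i := `|('D_(delta_mx 0 i) F x) a b| + 1.
have nA : nbhs x A by exact: open_nbhs_nbhs.
have nB : \forall y \near x, forall i : 'I_n, `|('D_(delta_mx 0 i) F y) a b| <= B i.
  have := @filter_forall _ _
    (fun i => [set y | `|('D_(delta_mx 0 i) F y) a b| <= B i]) (nbhs x) _.
  apply => i.
  have c1 : {for x, continuous (fun y => `|('D_(delta_mx 0 i) F y) a b|)}.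
    apply: (@continuous_comp _ _ _ (fun y => ('D_(delta_mx 0 i) F y) a b) Num.norm).
      apply: (@continuous_comp _ _ _ ('D_(delta_mx 0 i) F)
        (fun N : 'M[R]_(k, l) => N a b)); last exact: coord_continuous.
      by apply: (cfA (delta_mx 0 i)); rewrite inE.
    exact: norm_continuous.
  have : \forall r \near `|('D_(delta_mx 0 i) F x) a b|, r < B i.
    by apply: lt_nbhsl; rewrite ltrDl.
  by move/c1 => c2; near do apply: ltW.
have nAB : \forall y \near x,
    A y /\ forall i : 'I_n, `|('D_(delta_mx 0 i) F y) a b| <= B i.
  by near=> y; split; near: y.
have /nbhs_ballP[e /= e0 He] := nAB.
exists (\sum_i B i), (ball x e); first exact: nbhsx_ballx.
move=> y z xy xz.
pose c (s : R) := z + s *: (y - z).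
have dc (s : R) : is_derive s 1 c (y - z).
  have -> : c = cst z + (fun s : R => s *: (y - z)) by [].
  rewrite -[X in is_derive _ _ _ X]add0r; apply: is_deriveD.
  apply: DeriveDef; first by apply/derivable1_diffP.
  by rewrite deriveE// diff_val scale1r.
(* Balls are convex. *)
have cin (s : R) : s \in `[0, 1] -> ball x e (c s).
  rewrite in_itv /= => /andP[s0 s1]; move: xy xz; rewrite -!ball_normE /= => xy xz.
  have -> : x - c s = s *: (x - y) + (1 - s) *: (x - z).
    by apply/rowP => i; rewrite !mxE; ring.
  rewrite (le_lt_trans (ler_normD _ _))// !normrZ ger0_norm// ger0_norm ?subr_ge0//.
  have [->|sn0] := eqVneq s 0; first by rewrite mul0r add0r subr0 mul1r.
    (* A strict inequality is kept in the first term only, which is why s = 0 is set apart. *)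
  have -> : e = s * e + (1 - s) * e by ring.
  apply: ltr_leD; first by rewrite ltr_pM2l// lt_def sn0.
  by rewrite ler_wpM2l ?subr_ge0// ltW.
pose f (s : R) := F (c s) a b.
have dg (s : R) : s \in `[0, 1] -> is_derive s 1 f (('D_(y - z) F (c s)) a b).
  move=> /cin /He[Ac _].
  have d : is_derive s 1 (F \o c) ('D_(y - z) F (c s)).
    by apply: is_derive_curve => //; apply: dfA; rewrite inE.
  exact: (is_derive_coord a b d).
have dgo (s : R) : s \in `]0, 1[ -> is_derive s 1 f (('D_(y - z) F (c s)) a b).
  by move=> s01; apply: dg; exact: subset_itv_oo_cc s01.
have gc : {within `[0, 1], continuous f}.
  by apply: derivable_within_continuous => s /dg[].
have [s s01] := MVT_segment ler01 dgo gc.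
have c1 : c 1 = y by rewrite /c scale1r addrC subrK.
have c0 : c 0 = z by rewrite /c scale0r addr0.
rewrite /f c1 c0 subr0 mulr1 => ->.
have [Ac Bc] := He _ (cin _ s01).
rewrite derive_row_sum; last by apply: dfA; rewrite inE.
rewrite summxE (le_trans (ler_norm_sum _ _ _))// mulr_suml ler_sum// => i _.
by rewrite mxE normrM mulrC ler_pM//; exact: ler_coord_norm.
Unshelve. all: by end_near. Qed.

Lemma loclip_near_eq (V : normedModType R) (f g : V -> R) x :
  (\forall y \near x, f y = g y) -> loclip f x -> loclip g x.
Proof.
move=> fg [L [A xA H]]; exists L, (A `&` [set y | f y = g y]); first exact: filterI.
by move=> y z [Ay <-] [Az <-]; exact: H.
Qed.

End LocallyLipschitz.

(** * Charts, tangent vectors and metric compatibility *)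

Section Charts.
Context (R : realType) (n : nat) (M : riemannianManifold R n).
Implicit Types (p q : M) (x u v w : 'rV[R]_n) (c : R -> M).

Lemma param_chart p q : chart_dom p q -> param p (chart p q) = q.
Proof. by move=> pq; apply: chartK; rewrite inE. Qed.

Lemma chart_img_nbhs p q : chart_dom p q ->
  nbhs (chart p q) (chart p @` chart_dom p).
Proof.
by move=> pq; apply: open_nbhs_nbhs; split; [exact: chart_img_open|exists q].
Qed.

Lemma chart_dom_nbhs p q : chart_dom p q -> nbhs q (chart_dom p).
Proof. by move=> pq; apply: open_nbhs_nbhs; split; [exact: chart_dom_open|]. Qed.

Lemma param_cvg p q : chart_dom p q -> {for chart p q, continuous (param p)}.
Proof. by move=> pq; apply: param_continuous; rewrite inE; exists q. Qed.

Lemma param_nbhs p p' q : chart_dom p q -> chart_dom p' q ->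
  \forall y \near chart p q, chart_dom p' (param p y).
Proof.
move=> pq p'q; apply: (param_cvg pq); rewrite param_chart//.
exact: chart_dom_nbhs.
Qed.

Lemma transition_diff p p' q : chart_dom p q -> chart_dom p' q ->
  differentiable (chart p' \o param p) (chart p q).
Proof.
move=> pq p'q; have [+ _] := transition_smooth p p' 1; apply.
by rewrite inE; exists q.
Qed.

Lemma coord_changeE p p' q v : chart_dom p q -> chart_dom p' q ->
  coord_change p p' q v = 'D_v (chart p' \o param p) (chart p q).
Proof. by move=> pq p'q; rewrite deriveE//; exact: transition_diff. Qed.

Lemma coord_changeB p p' q u v :
  coord_change p p' q (u - v) = coord_change p p' q u - coord_change p p' q v.
Proof. by rewrite /coord_change linearB. Qed.

Lemma coord_changeZ p p' q (a : R) u :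
  coord_change p p' q (a *: u) = a *: coord_change p p' q u.
Proof. by rewrite /coord_change linearZ. Qed.

(** The chain rule for transition maps. *)
Lemma coord_change_comp p p' p'' q v :
  chart_dom p q -> chart_dom p' q -> chart_dom p'' q ->
  coord_change p' p'' q (coord_change p p' q v) = coord_change p p'' q v.
Proof.
move=> pq p'q p''q; rewrite [RHS]coord_changeE//.
have e : (chart p' \o param p) (chart p q) = chart p' q by rewrite /= param_chart.
have d1 := transition_diff pq p'q; have d2 := transition_diff p'q p''q.
rewrite -e in d2.
transitivity ('D_v ((chart p'' \o param p') \o (chart p' \o param p)) (chart p q)).
  rewrite [RHS]deriveE; last exact: differentiable_comp.
  by rewrite (diff_comp d1 d2) e.
apply: near_eq_derive; near=> y.
have yp' : chart_dom p' (param p y) by near: y; exact: param_nbhs.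
by rewrite /= param_chart.
Unshelve. all: by end_near. Qed.

Lemma coord_change_id p q v : chart_dom p q -> coord_change p p q v = v.
Proof.
move=> pq; rewrite coord_changeE// -[RHS](derive_id (chart p q) v).
apply: near_eq_derive; near=> y.
have [r rp <-] : (chart p @` chart_dom p) y by near: y; exact: chart_img_nbhs.
by rewrite /= param_chart.
Unshelve. all: by end_near. Qed.

Lemma curve_near_dom c t p : {for t, continuous c} -> chart_dom p (c t) ->
  \forall s \near t, chart_dom p (c s).
Proof. by move=> ct pt; apply: ct; exact: chart_dom_nbhs. Qed.

(** The velocity is defined in the chart selected at [c t], which varies with
    [t]; this moves the computation to a fixed chart, where it can be
    differentiated in [t]. *)
Lemma velocity_coord c t p : {for t, continuous c} -> chart_dom p (c t) ->
  derivable (chart p \o c) t 1 ->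
  velocity c t = coord_change p (c t) (c t) (derive1 (chart p \o c) t).
Proof.
move=> ct pt dx; have cct := chart_dom_center (c t).
rewrite coord_changeE// /velocity !derive1E.
have d : is_derive t 1 (chart p \o c) ('D_1 (chart p \o c) t) by exact: derivableP.
have := @is_derive_curve _ _ _ (chart (c t) \o param p) _ _ _ d (transition_diff pt cct).
move=> [_ <-]; apply: near_eq_derive.
near=> s; have ps : chart_dom p (c s) by near: s; exact: curve_near_dom.
by rewrite /= param_chart.
Unshelve. all: by end_near. Qed.

Lemma tinner_gram p q u v : chart_dom p q ->
  tinner (@gmetric R n M) q (coord_change p q q u) (coord_change p q q v) =
  \sum_(i < n) \sum_(j < n) u 0 i * v 0 j * gram p (chart p q) i j.
Proof.
move=> pq; pose f := 'd (chart q \o param p) (chart p q).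
have fE w : f w = \sum_k w 0 k *: f (delta_mx 0 k).
  by rewrite [in LHS](row_sum_delta w) linear_sum; apply: eq_bigr => k _; rewrite linearZ.
rewrite /tinner /coord_change -/f (fE u) (fE v) !mulmx_suml summxE.
apply: eq_bigr => i _; rewrite linear_sum mulmx_sumr summxE; apply: eq_bigr => j _.
rewrite !linearZ /= -!scalemxAl [LHS]mxE [X in _ * X]mxE.
by rewrite [gram _ _ _ _]mxE param_chart// -/f mulrCA mulrA.
Qed.

Lemma christoffel_formC p x u v : christoffel_form p x u v = christoffel_form p x v u.
Proof.
apply/rowP => k; rewrite !mxE exchange_big; apply: eq_bigr => i _; apply: eq_bigr => j _.
by rewrite christoffelC; ring.
Qed.

Lemma christoffel_formDr p x u v w :
  christoffel_form p x u (v + w) = christoffel_form p x u v + christoffel_form p x u w.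
Proof.
apply/rowP => k; rewrite !mxE -big_split; apply: eq_bigr => i _.
by rewrite -big_split; apply: eq_bigr => j _; rewrite mxE mulrDr.
Qed.

Lemma christoffel_formZr p x (a : R) u v :
  christoffel_form p x u (a *: v) = a *: christoffel_form p x u v.
Proof.
apply/rowP => k; rewrite !mxE mulr_sumr; apply: eq_bigr => i _.
by rewrite mulr_sumr; apply: eq_bigr => j _; rewrite mxE; ring.
Qed.

Lemma christoffel_formNN p x u :
  christoffel_form p x (- u) (- u) = christoffel_form p x u u.
Proof.
apply/rowP => k; rewrite !mxE; apply: eq_bigr => i _; apply: eq_bigr => j _.
by rewrite !mxE; ring.
Qed.

Lemma gram_diff p x : (chart p @` chart_dom p) x -> differentiable (gram p) x.
Proof. by move=> px; have [+ _] := @gmetric_smooth _ _ M p 1; apply; rewrite inE. Qed.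

Lemma is_derive_gram (c : R -> 'rV[R]_n) p t v i j :
  (chart p @` chart_dom p) (c t) -> is_derive t 1 c v ->
  is_derive t 1 (fun s => gram p (c s) i j)
    (\sum_(k < n) v 0 k * \sum_(l < n) (christoffel p (c t) l k i * gram p (c t) l j
                + christoffel p (c t) l k j * gram p (c t) i l)).
Proof.
move=> px dc; have dg := gram_diff px.
have d : is_derive t 1 (gram p \o c) ('D_v (gram p) (c t)) by exact: is_derive_curve.
have := is_derive_coord i j d; rewrite derive_row_sum// summxE.
congr is_derive; apply: eq_bigr => k _.
by rewrite mxE -christoffel_metric// derive_coord//; exact: diff_derivable.
Qed.

(** Compatibility of the connection with the metric, along a curve of velocity
    [v] in a chart: <a, b>' = <Da, b> + <a, Db>, where Da = a' + Gamma (v, a).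
    The derivative of the Gram matrix is given by [christoffel_metric], and its
    two Christoffel terms are regrouped with a' and with b'. *)
Lemma is_derive_metric (c a b : R -> 'rV[R]_n) p t v a' b' :
  (chart p @` chart_dom p) (c t) -> is_derive t 1 c v ->
  is_derive t 1 a a' -> is_derive t 1 b b' ->
  is_derive t 1
   (fun s => \sum_(i < n) \sum_(j < n) a s 0 i * b s 0 j * gram p (c s) i j)
   (\sum_(i < n) \sum_(j < n)
      (a' + christoffel_form p (c t) v (a t)) 0 i * b t 0 j * gram p (c t) i j +
    \sum_(i < n) \sum_(j < n)
      a t 0 i * (b' + christoffel_form p (c t) v (b t)) 0 j * gram p (c t) i j).
Proof.
move=> px dc da db.
pose G i j := \sum_(k < n) v 0 k * \sum_(l < n)
  (christoffel p (c t) l k i * gram p (c t) l j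
   + christoffel p (c t) l k j * gram p (c t) i l).
pose D i j := (a' 0 i * b t 0 j + a t 0 i * b' 0 j) * gram p (c t) i j
  + a t 0 i * b t 0 j * G i j.
have dD i j : is_derive t 1 (fun s => a s 0 i * b s 0 j * gram p (c s) i j) (D i j).
  have di := is_derive_coord 0 i da; have dj := is_derive_coord 0 j db.
  have dg : is_derive t 1 (fun s => gram p (c s) i j) (G i j) by exact: is_derive_gram.
  exact: is_derive_mul (is_derive_mul di dj) dg.
pose S i s := \sum_(j < n) a s 0 i * b s 0 j * gram p (c s) i j.
have dS i : is_derive t 1 (S i) (\sum_(j < n) D i j).
  have -> : S i = \sum_(j < n) (fun s => a s 0 i * b s 0 j * gram p (c s) i j).
    by apply/funext => s; rewrite fct_sumE.
  exact: is_derive_sum.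
have -> : (fun s => \sum_(i < n) \sum_(j < n) a s 0 i * b s 0 j * gram p (c s) i j) =
   \sum_(i < n) S i by apply/funext => s; rewrite fct_sumE.
apply: (is_derive_eq (is_derive_sum dS)).
transitivity (\sum_i \sum_j (a' 0 i * b t 0 j * gram p (c t) i j +
    a t 0 i * b' 0 j * gram p (c t) i j) + \sum_i \sum_j a t 0 i * b t 0 j * G i j).
  by rewrite -big_split; apply: eq_bigr => i _; rewrite -big_split; apply: eq_bigr => j _;
    rewrite /D /=; ring.
transitivity (\sum_i \sum_j (a' 0 i * b t 0 j * gram p (c t) i j +
    a t 0 i * b' 0 j * gram p (c t) i j) +
  (\sum_i \sum_j christoffel_form p (c t) v (a t) 0 i * b t 0 j * gram p (c t) i j +
   \sum_i \sum_j a t 0 i * christoffel_form p (c t) v (b t) 0 j * gram p (c t) i j)).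
  congr (_ + _).
  transitivity (\sum_i \sum_j \sum_k \sum_l
      (a t 0 i * b t 0 j * v 0 k * christoffel p (c t) l k i * gram p (c t) l j) +
    \sum_i \sum_j \sum_k \sum_l
      (a t 0 i * b t 0 j * v 0 k * christoffel p (c t) l k j * gram p (c t) i l)).
    rewrite -big_split; apply: eq_bigr => i _; rewrite -big_split; apply: eq_bigr => j _.
    rewrite /G mulr_sumr -big_split; apply: eq_bigr => k _.
    rewrite mulrA mulr_sumr -big_split; apply: eq_bigr => l _ /=; ring.
  congr (_ + _).
    transitivity (\sum_l \sum_j \sum_k \sum_i
      (a t 0 i * b t 0 j * v 0 k * christoffel p (c t) l k i * gram p (c t) l j)).
      rewrite exchange_big [RHS]exchange_big; apply: eq_bigr => j _ /=.
      rewrite exchange_big [RHS]exchange_big; apply: eq_bigr => k _ /=.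
      by rewrite exchange_big.
    apply: eq_bigr => l _; apply: eq_bigr => j _.
    rewrite [christoffel_form _ _ _ _ _ _]mxE !mulr_suml.
    apply: eq_bigr => k _; rewrite !mulr_suml; apply: eq_bigr => i _; ring.
  apply: eq_bigr => i _.
  transitivity (\sum_l \sum_k \sum_j
    (a t 0 i * b t 0 j * v 0 k * christoffel p (c t) l k j * gram p (c t) i l)).
    rewrite exchange_big [RHS]exchange_big; apply: eq_bigr => k _ /=.
    by rewrite exchange_big.
  apply: eq_bigr => l _; rewrite [christoffel_form _ _ _ _ _ _]mxE mulr_sumr !mulr_suml.
  apply: eq_bigr => k _; rewrite mulr_sumr !mulr_suml; apply: eq_bigr => j _; ring.
rewrite -!big_split; apply: eq_bigr => i _; rewrite -!big_split; apply: eq_bigr => j _.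
by rewrite [in RHS]mxE [X in _ = _ + _ * X * _]mxE /=; ring.
Qed.

(** The derivative of |X|^2 is 2 <X, DX>, for a field [X] along [c] with
    components [xi] in the chart at [p]. *)
Lemma is_derive_tinner_along c (X xi : R -> 'rV[R]_n) p t v xi' :
  {for t, continuous c} -> chart_dom p (c t) ->
  is_derive t 1 (chart p \o c) v -> is_derive t 1 xi xi' ->
  (\forall s \near t, X s = coord_change p (c s) (c s) (xi s)) ->
  is_derive t 1 (fun s => tinner (@gmetric R n M) (c s) (X s) (X s))
    (2 * tinner (@gmetric R n M) (c t) (X t)
      (coord_change p (c t) (c t)
        (xi' + christoffel_form p (chart p (c t)) v (xi t)))).
Proof.
move=> ct pt dc dxi EX.
have px : (chart p @` chart_dom p) ((chart p \o c) t) by exists (c t).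
have d := is_derive_metric px dc dxi dxi.
have T a b := @tinner_gram p (c t) a b pt.
have E : \forall s \near t,
    \sum_(i < n) \sum_(j < n) xi s 0 i * xi s 0 j * gram p ((chart p \o c) s) i j =
    tinner (@gmetric R n M) (c s) (X s) (X s).
  near=> s; have ps : chart_dom p (c s) by near: s; exact: curve_near_dom.
  have -> : X s = coord_change p (c s) (c s) (xi s) by near: s.
  by rewrite tinner_gram.
apply: (is_derive_eq (near_eq_is_derive E d)).
rewrite (nbhs_singleton EX); set D := xi' + _.
transitivity (tinner (@gmetric R n M) (c t) (coord_change p (c t) (c t) D)
    (coord_change p (c t) (c t) (xi t)) +
  tinner (@gmetric R n M) (c t) (coord_change p (c t) (c t) (xi t))
    (coord_change p (c t) (c t) D)); first by rewrite !T.
by rewrite [X in X + _ = _]tinnerC mulr2n mulrDl mul1r.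
Unshelve. all: by end_near. Qed.

End Charts.

(** * Geodesics: speed, length and time reversal *)

Section Geodesics.
Context (R : realType) (n : nat) (M : riemannianManifold R n).
Implicit Types (p q : M) (x u v w : 'rV[R]_n) (c : R -> M) (t : R).
Local Notation ginner := (tinner (@gmetric R n M)).

(** The condition at a single time in [geodesic_segment]. *)
Definition geodesic_at c t : Prop :=
  {for t, continuous c} /\
  forall p, chart_dom p (c t) ->
    let x := chart p \o c in
    let x' := derive1 x in
    [/\ derivable x t 1, derivable x' t 1 &
        derive1 x' t + christoffel_form p (x t) (x' t) (x' t) = 0].

Lemma geodesic_near c (e : R) t : {in `]- e, 1 + e[, forall t, geodesic_at c t} ->
  t \in `]- e, 1 + e[ -> \forall s \near t, geodesic_at c s.
Proof. by move=> cg /near_in_itvoo; apply: filterS => s /cg. Qed.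

Lemma tinner0r q u : ginner q u 0 = 0.
Proof. by rewrite /tinner trmx0 mulmx0 mxE. Qed.

Lemma geodesic_velocity_near c t p : (\forall s \near t, geodesic_at c s) ->
  chart_dom p (c t) ->
  \forall s \near t, velocity c s = coord_change p (c s) (c s) (derive1 (chart p \o c) s).
Proof.
move=> cg pt; have [ct _] := nbhs_singleton cg.
near=> s; have [cs gs] : geodesic_at c s by near: s.
have ps : chart_dom p (c s) by near: s; exact: curve_near_dom.
by apply: velocity_coord => //; have [] := gs _ ps.
Unshelve. all: by end_near. Qed.

(** The covariant derivative of the velocity of a geodesic is zero. *)
Lemma is_derive_speed c t : (\forall s \near t, geodesic_at c s) ->
  is_derive t 1 (fun s => ginner (c s) (velocity c s) (velocity c s)) 0.
Proof.
move=> cg; have [ct gt] := nbhs_singleton cg.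
have pt := chart_dom_center (c t); have [dx ddx eq0] := gt _ pt.
have vx : is_derive t 1 (chart (c t) \o c) (derive1 (chart (c t) \o c) t).
  by rewrite derive1E; exact: derivableP.
have vv : is_derive t 1 (derive1 (chart (c t) \o c)) (derive1 (derive1 (chart (c t) \o c)) t).
  by rewrite [X in is_derive _ _ _ X]derive1E; exact: derivableP.
apply: (is_derive_eq (is_derive_tinner_along ct pt vx vv (geodesic_velocity_near cg pt))).
by rewrite eq0 /coord_change linear0 tinner0r mulr0.
Qed.

Lemma geodesic_speed c (e : R) t : 0 < e ->
  {in `]- e, 1 + e[, forall t, geodesic_at c t} -> t \in `[0, 1] ->
  tnorm (c t) (velocity c t) = tnorm (c 0) (velocity c 0).
Proof.
move=> e0 cg t01; congr Num.sqrt.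
have D (s : R) : s \in `[0, t] ->
    is_derive s 1 (fun s => ginner (c s) (velocity c s) (velocity c s)) 0.
  move: t01; rewrite !in_itv /= => /andP[t0 t1] /andP[s0 st].
  apply: is_derive_speed; apply: (geodesic_near cg); rewrite in_itv /=.
  by apply/andP; split; lra.
have t0 : 0 <= t by move: t01; rewrite in_itv /= => /andP[].
have Do (s : R) : s \in `]0, t[ ->
    is_derive s 1 (fun s => ginner (c s) (velocity c s) (velocity c s)) ((fun=> 0) s).
  by move=> s0t; apply: D; exact: subset_itv_oo_cc s0t.
have Dc : {within `[0, t], continuous (fun s => ginner (c s) (velocity c s) (velocity c s))}.
  by apply: derivable_within_continuous => s /D[].
have [s _] := MVT_segment t0 Do Dc.
by rewrite mul0r => /eqP; rewrite subr_eq0 => /eqP.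
Qed.

Lemma geodesic_C1 c : geodesic_segment c -> C1_segment c.
Proof.
move=> [e e0 cg]; exists e; first exact: e0.
move=> t te; have [ct gt] := cg t te.
split; first exact: ct.
move=> p pt; have [dx ddx _] := gt p pt; split; first exact: dx.
apply: differentiable_continuous; apply/derivable1_diffP.
exact: ddx.
Qed.

Lemma geodesic_length c : geodesic_segment c ->
  curve_length c = (tnorm (c 0) (velocity c 0))%:E.
Proof.
move=> [e e0 cg]; rewrite /curve_length.
rewrite (eq_integral (fun=> (tnorm (c 0) (velocity c 0))%:E)); last first.
  by move=> t /[!inE] t01; rewrite (geodesic_speed e0 cg).
rewrite integral_cst//= lebesgue_measure_itv/= lte_fin ltr01.
by rewrite -EFinB subr0 mule1.
Qed.

Definition reverse c : R -> M := fun t => c (1 - t).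

Lemma is_derive_onem (V : normedModType R) (f : R -> V) t f' :
  is_derive (1 - t) 1 f f' -> is_derive t 1 (fun s => f (1 - s)) (- f').
Proof.
move=> [df <-]; have df' : differentiable f (1 - t) by exact/derivable1_diffP.
have d1 : is_derive t 1 (fun s : R => 1 - s) (-1).
  by rewrite -[-1]add0r; apply: is_deriveB.
apply: (is_derive_eq (is_derive_curve d1 df')).
by rewrite !deriveE// linearN.
Qed.

Lemma cvg_onem t : {for t, continuous (fun s : R => 1 - s)}.
Proof. by apply: cvgB; [exact: cvg_cst|exact: cvg_id]. Qed.

Lemma is_derive_reverse c p t : geodesic_at c (1 - t) ->
  chart_dom p (c (1 - t)) ->
  is_derive t 1 (chart p \o reverse c) (- derive1 (chart p \o c) (1 - t)).
Proof.
move=> [_ gt] pt; have [dx _ _] := gt _ pt.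
apply: (@is_derive_onem _ (chart p \o c)).
by rewrite derive1E; exact: derivableP.
Qed.

(** Reversing time changes the sign of the velocity and keeps the second
    derivative; the Christoffel term is quadratic in the velocity. *)
Lemma reverse_geodesic_at c t : (\forall s \near 1 - t, geodesic_at c s) ->
  geodesic_at (reverse c) t.
Proof.
move=> cg; have [ct gt] := nbhs_singleton cg.
have cr : {for t, continuous (reverse c)}.
  by apply: (continuous_comp (@cvg_onem t)); exact: ct.
split; first exact: cr.
move=> p pt x x'; have [dx ddx eq0] := gt p pt.
have dr := is_derive_reverse (nbhs_singleton cg) pt.
have Ex' : \forall s \near t, - derive1 (chart p \o c) (1 - s) = x' s.
  have cg' : \forall s \near t, geodesic_at c (1 - s) by exact: (@cvg_onem t) cg.
  have ps' : \forall s \near t, chart_dom p (reverse c s) by exact: curve_near_dom.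
  near=> s; have gs : geodesic_at c (1 - s) by near: s.
  have ps : chart_dom p (c (1 - s)) by near: s.
  have [_ h] := is_derive_reverse gs ps.
  by rewrite /x' /x [RHS]derive1E h.
have ddr : is_derive t 1 x' (derive1 (derive1 (chart p \o c)) (1 - t)).
  apply: (near_eq_is_derive Ex'); rewrite -[X in is_derive _ _ _ X]opprK.
  apply: is_deriveN; apply: is_derive_onem.
  by rewrite derive1E; exact: derivableP.
split; [by case: dr|by case: ddr|].
have [_ h] := ddr; rewrite [X in X + _]derive1E h.
by rewrite -(nbhs_singleton Ex') christoffel_formNN.
Unshelve. all: by end_near. Qed.

Lemma reverse_geodesic c : geodesic_segment c -> geodesic_segment (reverse c).
Proof.
move=> [e e0 cg]; exists e; first exact: e0.
move=> t; rewrite in_itv /= => /andP[te1 te2].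
apply: reverse_geodesic_at; apply: (geodesic_near cg).
by rewrite in_itv /=; apply/andP; split; lra.
Qed.

Lemma velocity_reverse c t : geodesic_at c (1 - t) ->
  velocity (reverse c) t = - velocity c (1 - t).
Proof.
move=> cg; rewrite /velocity derive1E.
by have [_ h] := is_derive_reverse cg (chart_dom_center _); exact: h.
Qed.

Lemma tnormN q u : tnorm q (- u) = tnorm q u.
Proof. by rewrite /tnorm /tinner linearN mulmxN !mulNmx opprK. Qed.

Lemma geodesic_at_segment c t : geodesic_segment c -> t \in `[0, 1] ->
  \forall s \near t, geodesic_at c s.
Proof.
move=> [e e0 cg]; rewrite in_itv /= => /andP[t0 t1]; apply: (geodesic_near cg).
by rewrite in_itv /=; apply/andP; split; lra.
Qed.

Lemma reverse_speed c : geodesic_segment c ->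
  tnorm (reverse c 0) (velocity (reverse c) 0) = tnorm (c 0) (velocity c 0).
Proof.
move=> cg; have i1 : 1 \in `[0 : R, 1] by rewrite in_itv /= ler01 lexx.
rewrite velocity_reverse ?subr0; last exact: nbhs_singleton (geodesic_at_segment cg i1).
rewrite /reverse subr0 tnormN; have [e e0 cg'] := cg.
exact: (geodesic_speed e0 cg' i1).
Qed.

(** The reversed curve is the competitor, because the paths in [rdist p q] run
    from [p] to [q]. *)
Lemma rdist_reverse_le c : geodesic_segment c ->
  (rdist (c 1%R) (c 0%R) <= (tnorm (c 0%R) (velocity c 0%R))%:E)%E.
Proof.
move=> cg; apply: ereal_inf_lbound; exists [:: reverse c].
  split; [exact/geodesic_C1/reverse_geodesic|by rewrite /reverse subr0|].
  by rewrite /= /reverse subrr.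
rewrite /path_length big_seq1 geodesic_length; last exact: reverse_geodesic.
by rewrite reverse_speed.
Qed.

End Geodesics.

(** * Three one-variable principles *)

Section Uniqueness.
Context (R : realType).

(** Induction on a real interval: look at the infimum of the set of
    counterexamples.  At [t = a] the hypothesis of the first premise is void, so
    that premise contains the base case. *)
Lemma itv_induction (P : R -> Prop) (a b : R) :
  (forall t, a <= t <= b -> (forall s, a <= s < t -> P s) -> P t) ->
  (forall t, a <= t < b -> (forall s, a <= s <= t -> P s) ->
     \forall s \near t, t <= s -> P s) ->
  forall t, a <= t <= b -> P t.
Proof.
move=> Pclosed Popen t tab; apply: contrapT => nPt.
pose B := [set s : R | a <= s <= b /\ ~ P s].
have Bt : B t by [].
have lbB : has_lbound B by exists a => s [/andP[]].
have hB : has_inf B by split; [exists t|].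
pose m := inf B.
have am : a <= m by apply: lb_le_inf; [exists t|move=> s [/andP[]]].
have mt : m <= t by exact: ge_inf.
have /andP[ta tb] := tab.
have Plt s : a <= s < m -> P s.
  move=> /andP[as_ sm]; apply: contrapT => nPs.
  have : m <= s.
    by apply: ge_inf => //; split=> //; rewrite as_ (le_trans (ltW sm))// (le_trans mt).
  by rewrite leNgt sm.
have Pm : P m by apply: Pclosed => //; rewrite am (le_trans mt).
have mltt : m < t by rewrite lt_neqAle mt andbT; apply/eqP => mE; apply: nPt; rewrite -mE.
have /nbhs_ballP[e /= e0 He] : \forall s \near m, m <= s -> P s.
  apply: Popen; first by rewrite am (lt_le_trans mltt).
  move=> s /andP[as_]; rewrite le_eqVlt => /orP[/eqP->//|sm].
  by apply: Plt; rewrite as_.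
have [s [sab nPs] sme] := inf_adherent e0 hB.
have ms : m <= s by apply: ge_inf.
apply: nPs; apply: He => //.
by rewrite -ball_normE /= distrC ger0_norm ?subr_ge0// ltrBlDl.
Qed.

(** A derivative can be computed as a limit from the left. *)
Lemma derive_eq_left n (f g : R -> 'rV[R]_n) (a t : R) : a < t ->
  (forall s, a <= s <= t -> f s = g s) ->
  derivable f t 1 -> derivable g t 1 -> derive1 f t = derive1 g t.
Proof.
move=> at_ fg df dg; rewrite !derive1E.
have ef : 'D_1 f t = lim (h^-1 *: (f (h *: 1 + t) - f t) @[h --> 0^'-]).
  exact: (@cvg_at_leftE _ _ _ _ df).
have eg : 'D_1 g t = lim (h^-1 *: (g (h *: 1 + t) - g t) @[h --> 0^'-]).
  exact: (@cvg_at_leftE _ _ _ _ dg).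
have E : \forall h \near (0 : R)^'-, h^-1 *: (f (h *: 1 + t) - f t) =
    h^-1 *: (g (h *: 1 + t) - g t).
  near=> h; have h0 : h < 0 by near: h; exact: nbhs_left_lt.
  have ha : a - t < h by near: h; apply: nbhs_left_gt; rewrite subr_lt0.
  have hE : h *: 1 = h by rewrite /GRing.scale /= mulr1.
  have e1 : f (h + t) = g (h + t) by apply: fg; apply/andP; split; lra.
  have e2 : f t = g t by apply: fg; rewrite lexx ltW.
  by rewrite hE e1 e2.
rewrite ef eg; congr (lim _); rewrite eqEsubset; split; apply: near_eq_cvg.
  by apply: filterS E => h /esym.
by apply: filterS E => h.
Unshelve. all: by end_near. Qed.

(** [E t * expR (- K * t)] is nonincreasing. *)
Lemma gronwall0 (E dE : R -> R) (K a b : R) : a <= b ->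
  (forall t, a <= t <= b -> is_derive t 1 E (dE t)) ->
  (forall t, a <= t <= b -> dE t <= K * E t) ->
  E a = 0 -> E b <= 0.
Proof.
move=> ab dEE leE Ea.
pose G t := E t * expR (- K * t).
pose dG t := dE t * expR (- K * t) + E t * (expR (- K * t) * - K).
have dGG t : a <= t <= b -> is_derive t 1 G (dG t).
  move=> tab; apply: is_derive_mul; first exact: dEE.
  have dK : is_derive t 1 (fun t : R => - K * t) (- K).
    have := @is_derive_mul R (fun=> - K) id t 0 1 (is_derive_cst _ _ _) (is_derive_id _ _).
    by rewrite mul0r add0r mulr1.
  exact: (is_derive1_comp (is_derive_expR _) dK).
have dGo t : t \in `]a, b[ -> is_derive t 1 G (dG t).
  by rewrite in_itv /= => /andP[at_ tb]; apply: dGG; rewrite !ltW.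
have cG : {within `[a, b], continuous G}.
  by apply: derivable_within_continuous => t; rewrite in_itv /= => /dGG[].
have [c cab] := MVT_segment ab dGo cG.
rewrite in_itv /= in cab.
rewrite {2}/G Ea mul0r subr0 => Gb.
have : G b <= 0.
  rewrite Gb mulr_le0_ge0 ?subr_ge0//.
  have -> : dG c = (dE c - K * E c) * expR (- K * c) by rewrite /dG; ring.
  by rewrite mulr_le0_ge0 ?expR_ge0// subr_le0 leE.
by rewrite /G pmulr_lle0 ?expR_gt0.
Qed.

(** There are finitely many entries: sum the constants and intersect the
    neighbourhoods. *)
Lemma loclip_row (V : normedModType R) n (F : V -> 'rV[R]_n) z :
  (forall i, loclip (fun y => F y 0 i) z) ->
  exists2 L, 0 <= L & exists2 A, nbhs z A &
    forall y y', A y -> A y' -> forall i, `|F y 0 i - F y' 0 i| <= L * `|y - y'|.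
Proof.
move=> /(_ _)/loclipW Fl.
have /choice[L HL] : forall i, exists L, 0 <= L /\ exists2 A, nbhs z A &
    forall y y', A y -> A y' -> `|F y 0 i - F y' 0 i| <= L * `|y - y'|.
  by move=> i; have [L] := Fl i; exists L.
have /choice[A HA] : forall i, exists A, nbhs z A /\
    forall y y', A y -> A y' -> `|F y 0 i - F y' 0 i| <= L i * `|y - y'|.
  by move=> i; have [_ [A]] := HL i; exists A.
exists (\sum_i L i); first by apply: sumr_ge0 => i _; have [] := HL i.
exists [set y | forall i, A i y].
  by have := @filter_forall _ _ A (nbhs z) _; apply => i; have [] := HA i.
move=> y y' Ay Ay' i; have [_ H] := HA i.
apply: le_trans (H _ _ (Ay i) (Ay' i)) _; rewrite ler_wpM2r//.
by rewrite (bigD1 i)//= lerDl sumr_ge0// => j _; have [] := HL j.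
Qed.

End Uniqueness.

(** * Uniqueness of geodesics *)

Section GeodesicUniqueness.
Context (R : realType) (n : nat).

(** The second-order equation x'' = F (x, x') as a first-order system. *)
Definition solves (F : 'rV[R]_n * 'rV[R]_n -> 'rV[R]_n) (x v : R -> 'rV[R]_n)
    (s : R) : Prop :=
  is_derive s 1 x (v s) /\ is_derive s 1 v (F (x s, v s)).

(** Let [E] be the sum of the squares of the coordinates of [x1 - x2] and
    [v1 - v2].  The Lipschitz bound gives E' <= K E, and E vanishes at [t],
    hence after [t] as well. *)
Lemma ode_unique (F : 'rV[R]_n * 'rV[R]_n -> 'rV[R]_n) (x1 x2 v1 v2 : R -> 'rV[R]_n)
    (t : R) :
  (\forall s \near t, solves F x1 v1 s) ->
  (\forall s \near t, solves F x2 v2 s) ->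
  x1 t = x2 t -> v1 t = v2 t ->
  (forall i, loclip (fun z => F z 0 i) (x1 t, v1 t)) ->
  \forall s \near t, t <= s -> x1 s = x2 s.
Proof.
move=> D1 D2 ex ev /loclip_row[L L0 [A zA HA]].
have cz (x v : R -> 'rV[R]_n) :
    (\forall s \near t, solves F x v s) ->
    (x t, v t) = (x1 t, v1 t) -> \forall s \near t, A (x s, v s).
  move=> /nbhs_singleton[/is_derive_continuous cx /is_derive_continuous cv] e.
  have : {for t, continuous (fun s => (x s, v s))}.
    exact: (@cvg_pair _ _ _ (nbhs t) _ _ _ _ _ x v cx cv).
  by apply; rewrite e.
have A1 := cz _ _ D1 erefl.
have A2 : \forall s \near t, A (x2 s, v2 s) by apply: cz => //; rewrite ex ev.
have /nbhs_ballP[e /= e0 He] : \forall s \near t,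
    [/\ solves F x1 v1 s, solves F x2 v2 s, A (x1 s, v1 s) & A (x2 s, v2 s)].
  by near=> s; split; near: s.
apply/nbhs_ballP; exists e => //= b tb tleb.
pose f i s := x1 s 0 i - x2 s 0 i.
pose g i s := v1 s 0 i - v2 s 0 i.
pose h i s := F (x1 s, v1 s) 0 i - F (x2 s, v2 s) 0 i.
pose E s := \sum_(i < n) (f i s * f i s + g i s * g i s).
pose dE s := \sum_(i < n) ((g i s * f i s + f i s * g i s) + (h i s * g i s + g i s * h i s)).
have sin s : t <= s <= b -> ball t e s.
  move=> /andP[ts sb]; move: tb; rewrite -!ball_normE /= distrC ger0_norm ?subr_ge0//.
  by move=> h1; rewrite distrC ger0_norm ?subr_ge0//; lra.
have dEE s : t <= s <= b -> is_derive s 1 E (dE s).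
  move=> /sin /He[[dx1 dv1] [dx2 dv2] _ _].
  pose S i s := f i s * f i s + g i s * g i s.
  have -> : E = \sum_(i < n) S i by apply/funext => r; rewrite fct_sumE.
  apply: is_derive_sum => i.
  have df : is_derive s 1 (f i) (g i s).
    by apply: is_deriveB; exact: is_derive_coord.
  have dg : is_derive s 1 (g i) (h i s).
    by apply: is_deriveB; exact: is_derive_coord.
  by apply: is_deriveD; exact: is_derive_mul.
have fE i s : `|f i s| <= Num.sqrt (E s).
  rewrite -sqrtr_sqr ler_wsqrtr// /E (bigD1 i)//= expr2 -addrA lerDl.
  by rewrite addr_ge0 ?sqr_ge0 -?expr2 ?sqr_ge0// sumr_ge0// => j _;
    rewrite addr_ge0 -?expr2 ?sqr_ge0.
have gE i s : `|g i s| <= Num.sqrt (E s).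
  rewrite -sqrtr_sqr ler_wsqrtr// /E (bigD1 i)//= expr2 addrAC lerDr.
  by rewrite addr_ge0 ?sqr_ge0 -?expr2 ?sqr_ge0// sumr_ge0// => j _;
    rewrite addr_ge0 -?expr2 ?sqr_ge0.
have E0 s : 0 <= E s.
  by apply: sumr_ge0 => j _; rewrite addr_ge0 -?expr2 ?sqr_ge0.
have zE s : `|(x1 s, v1 s) - (x2 s, v2 s)| <= Num.sqrt (E s).
  rewrite prod_normE ge_max /=; apply/andP; split.
    rewrite [leLHS]/Num.Def.normr/= mx_normrE (bigmax_le _ (sqrtr_ge0 _))//= => -[i0 i] _.
    by rewrite ord1 !mxE; exact: fE.
  rewrite [leLHS]/Num.Def.normr/= mx_normrE (bigmax_le _ (sqrtr_ge0 _))//= => -[i0 i] _.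
  by rewrite ord1 !mxE; exact: gE.
have dEle s : t <= s <= b -> dE s <= (\sum_(i < n) (2 + 2 * L)) * E s.
  move=> /sin /He[_ _ a1 a2]; rewrite mulr_suml; apply: ler_sum => i _.
  have hE : `|h i s| <= L * Num.sqrt (E s).
    by apply: le_trans (HA _ _ a1 a2 i) _; rewrite ler_wpM2l.
  have fg : f i s * g i s <= E s.
    rewrite -[E s]sqr_sqrtr// expr2 (le_trans (ler_norm _))// normrM.
    by rewrite ler_pM.
  have gh : g i s * h i s <= L * E s.
    rewrite -[E s]sqr_sqrtr// expr2 mulrCA (le_trans (ler_norm _))// normrM.
    by rewrite ler_pM.
  have -> : g i s * f i s + f i s * g i s + (h i s * g i s + g i s * h i s) =
    2 * (f i s * g i s) + 2 * (g i s * h i s) by ring.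
  by rewrite [leRHS]mulrDl -[2 * L * _]mulrA lerD// ler_wpM2l.
have Et : E t = 0.
  by rewrite /E big1// => i _; rewrite /f /g ex ev !subrr mul0r addr0.
have Eb := gronwall0 tleb dEE dEle Et.
apply/rowP => i; apply/eqP; rewrite -subr_eq0 -normr_le0.
by apply: le_trans (fE i b) _; rewrite ler0_sqrtr.
Unshelve. all: by end_near. Qed.

Context (M : riemannianManifold R n).
Implicit Types (p q : M) (x u v w : 'rV[R]_n) (c : R -> M) (t : R).

Lemma loclip_gram p q i j : chart_dom p q ->
  loclip (fun y => gram p y i j) (chart p q).
Proof.
move=> pq; have img : (chart p @` chart_dom p) (chart p q) by exists q.
exact: (@C1_loclip _ _ _ _ _ (gram p) _ i j (@chart_img_open _ _ M p) img
  (@gmetric_smooth _ _ M p 1)).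
Qed.

(** The Gram matrix is C^2, so its partial derivatives are C^1. *)
Lemma loclip_dgram p q i j v : chart_dom p q ->
  loclip ('D_v (fun y => gram p y i j)) (chart p q).
Proof.
move=> pq; have [_ g1] := @gmetric_smooth _ _ M p 2.
have L : loclip (fun y => ('D_v (gram p) y) i j) (chart p q).
  have img : (chart p @` chart_dom p) (chart p q) by exists q.
  exact: (@C1_loclip _ _ _ _ _ ('D_v (gram p)) _ i j (@chart_img_open _ _ M p) img (g1 v)).
apply: loclip_near_eq L; near=> y.
rewrite derive_coord//; apply: diff_derivable; apply: gram_diff.
by near: y; exact: chart_img_nbhs.
Unshelve. all: by end_near. Qed.

Lemma loclip_christoffel p q k i j : chart_dom p q ->
  loclip (fun y => christoffel p y k i j) (chart p q).
Proof.
move=> pq; apply: loclipM; first exact: loclip_cst.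
apply: loclip_sum => l _; apply: loclipM.
  apply: loclip_invmx => [|a b]; last exact: loclip_gram.
  by near=> y; apply: gram_unit; near: y; exact: chart_img_nbhs.
apply: loclipD; first by apply: loclipD; exact: loclip_dgram.
under eq_fun do rewrite -mulN1r.
by apply: loclipM; [exact: loclip_cst|exact: loclip_dgram].
Unshelve. all: by end_near. Qed.

(** The right-hand side of the geodesic equation.  Position and velocity form
    one variable, as in [solves], so that [ode_unique] applies. *)
Lemma loclip_spray p q v k : chart_dom p q ->
  loclip (fun z : 'rV[R]_n * 'rV[R]_n => (- christoffel_form p z.1 z.2 z.2) 0 k)
    (chart p q, v).
Proof.
move=> pq.
have cl i : loclip (fun z : 'rV[R]_n * 'rV[R]_n => z.2 0 i) (chart p q, v).
  exists 1, setT; first exact: filterT.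
  move=> y z _ _; rewrite mul1r.
  have -> : y.2 0 i - z.2 0 i = (y - z).2 0 i by rewrite !mxE.
  by rewrite (le_trans (ler_coord_norm _ _ _))// prod_normE le_max lexx orbT.
have : loclip (fun z : 'rV[R]_n * 'rV[R]_n => - 1 * \sum_(i < n) \sum_(j < n)
    christoffel p z.1 k i j * z.2 0 i * z.2 0 j) (chart p q, v).
  apply: loclipM; first exact: loclip_cst.
  apply: loclip_sum => i _; apply: loclip_sum => j _.
  apply: loclipM => //; apply: loclipM => //.
  apply: (@loclip_comp _ _ _ fst (fun y => christoffel p y k i j)).
  - by move=> y z; rewrite prod_normE le_max lexx.
  - exact: cvg_fst.
  - exact: loclip_christoffel.
by under [X in loclip X]eq_fun do rewrite mulN1r;
  under [X in _ -> loclip X _]eq_fun do rewrite !mxE.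
Qed.

(** In the chart at the common point, both curves solve the same system, with the
    same initial data. *)
Lemma geodesic_local_unique (c1 c2 : R -> M) t :
  (\forall s \near t, geodesic_at c1 s) -> (\forall s \near t, geodesic_at c2 s) ->
  c1 t = c2 t -> velocity c1 t = velocity c2 t ->
  \forall s \near t, t <= s -> c1 s = c2 s.
Proof.
move=> g1 g2 e12 ev; pose p := c1 t.
have p1 : chart_dom p (c1 t) by exact: chart_dom_center.
have p2 : chart_dom p (c2 t) by rewrite -e12.
have [ct1 _] := nbhs_singleton g1; have [ct2 _] := nbhs_singleton g2.
have n1 := curve_near_dom ct1 p1; have n2 := curve_near_dom ct2 p2.
have D c : (\forall s \near t, geodesic_at c s) ->
    (\forall s \near t, chart_dom p (c s)) ->
    \forall s \near t,
     solves (fun z => - christoffel_form p z.1 z.2 z.2)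
       (chart p \o c) (derive1 (chart p \o c)) s.
  move=> gc nc; near=> s.
  have [_ gs] : geodesic_at c s by near: s.
  have ps : chart_dom p (c s) by near: s.
  have [dx ddx eq0] := gs p ps; split.
    by rewrite derive1E; exact: derivableP.
  have -> : - christoffel_form p (chart p (c s)) (derive1 (chart p \o c) s)
      (derive1 (chart p \o c) s) = derive1 (derive1 (chart p \o c)) s.
    by apply/esym/eqP; rewrite -addr_eq0; apply/eqP; exact: eq0.
  by rewrite [X in is_derive _ _ _ X]derive1E; exact: derivableP.
have H := @ode_unique (fun z => - christoffel_form p z.1 z.2 z.2)
  (chart p \o c1) (chart p \o c2) _ _ t (D _ g1 n1) (D _ g2 n2).
have : \forall s \near t, t <= s -> (chart p \o c1) s = (chart p \o c2) s.
  apply: H; first by rewrite /= e12.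
    by move: ev; rewrite /velocity -e12.
  by move=> i; exact: loclip_spray.
move=> H'; near=> s => ts.
have q1 : chart_dom p (c1 s) by near: s.
have q2 : chart_dom p (c2 s) by near: s.
rewrite -(param_chart q1) -(param_chart q2); congr (param p _).
by move: ts; near: s.
Unshelve. all: by end_near. Qed.

(** The set of times up to which the two curves agree is closed because [M] is
    Hausdorff.  It is open to the right by [geodesic_local_unique]: once
    the curves agree on an interval ending at [t], so do their velocities
    at [t], by one-sided derivatives. *)
Lemma geodesic_unique (c1 c2 : R -> M) : geodesic_segment c1 -> geodesic_segment c2 ->
  c1 0 = c2 0 -> velocity c1 0 = velocity c2 0 -> {in `[0, 1], c1 =1 c2}.
Proof.
move=> g1 g2 e0 ev t; rewrite in_itv /=; move: t.
have G c t : geodesic_segment c -> 0 <= t <= 1 -> \forall s \near t, geodesic_at c s.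
  by move=> gc t01; apply: geodesic_at_segment => //; rewrite in_itv.
apply: itv_induction => t t01 H.
  have [tE|t0] := eqVneq t 0; first by rewrite tE.
  apply: (@carrier_hausdorff _ _ M) => A B tA tB.
  have [ct1 _] := nbhs_singleton (G _ _ g1 t01).
  have [ct2 _] := nbhs_singleton (G _ _ g2 t01).
  have nA : \forall s \near t, A (c1 s) by exact: ct1.
  have nB : \forall s \near t, B (c2 s) by exact: ct2.
  have /nbhs_ballP[e /= e0' He] : \forall s \near t, A (c1 s) /\ B (c2 s).
    by near=> s; split; near: s.
  (* A time before [t] at which both curves are in the neighbourhoods. *)
  pose s := Num.max (t / 2) (t - e / 2).
  have t_gt0 : 0 < t by rewrite lt_def t0; case/andP: t01.
  have s0 : 0 <= s < t.
    rewrite /s le_max divr_ge0 ?(ltW t_gt0)//= gt_max; apply/andP; split; lra.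
  have [|As Bs] := He s.
    rewrite -ball_normE /= gtr0_norm ?subr_gt0; last by case/andP: s0.
    rewrite ltrBlDl -ltrBlDr /s lt_max; apply/orP; right; lra.
  by exists (c1 s); split => //; rewrite (H _ s0).
have t01' : 0 <= t <= 1 by case/andP: t01 => -> /ltW.
apply: geodesic_local_unique; [exact: G|exact: G| |].
  by apply: H; rewrite lexx andbT; case/andP: t01.
have [tE|t0] := eqVneq t 0; first by rewrite tE.
have t_gt0 : 0 < t by rewrite lt_def t0; case/andP: t01.
have et : c1 t = c2 t by apply: H; rewrite lexx ltW.
have [_ d1] := nbhs_singleton (G _ _ g1 t01').
have [_ d2] := nbhs_singleton (G _ _ g2 t01').
have [dx1 _ _] := d1 _ (chart_dom_center _).
have p2 : chart_dom (c1 t) (c2 t) by rewrite et; exact: chart_dom_center.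
have [dx2 _ _] := d2 _ p2.
rewrite /velocity -et; apply: (derive_eq_left t_gt0 _ dx1 dx2) => s s0t.
by congr (chart (c1 t) _); exact: H.
Unshelve. all: by end_near. Qed.

(** [Exp] picks the end point of some geodesic with the given initial data; by
    uniqueness there is only one. *)
Lemma Exp_geodesic p v c : geodesic_from p v c -> Exp p v = c 1.
Proof.
move=> [gc c0 vc]; rewrite /Exp.
have : [set q | exists2 c, geodesic_from p v c & c 1 = q] (c 1) by exists c.
move=> /(xgetI p) /= [c' [gc' c0' vc'] <-].
have i1 : 1 \in `[0 : R, 1] by rewrite in_itv /= ler01 lexx.
by apply: (geodesic_unique gc' gc _ _ i1); rewrite ?c0 ?c0' ?vc ?vc'.
Qed.

End GeodesicUniqueness.

(** * The growth of a vector field along a geodesic *)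

Section Estimate.
Context (R : realType) (n : nat) (M : riemannianManifold R n).
Implicit Types (p q : M) (x u v w : 'rV[R]_n) (c : R -> M) (t : R).
Local Notation ginner := (tinner (@gmetric R n M)).

Lemma tinnerDr q u v w : ginner q u (v + w) = ginner q u v + ginner q u w.
Proof. by rewrite /tinner linearD mulmxDr mxE. Qed.

Lemma tinnerZr q (a : R) u v : ginner q u (a *: v) = a * ginner q u v.
Proof. by rewrite /tinner linearZ /= -scalemxAr mxE. Qed.

Lemma tinner_ge0 q u : 0 <= ginner q u u.
Proof.
have [->|u0] := eqVneq u 0; first by rewrite tinner0r.
by apply/ltW; exact: gmetric_posdef.
Qed.

Lemma sqr_tnorm q u : tnorm q u ^+ 2 = ginner q u u.
Proof. by rewrite sqr_sqrtr// tinner_ge0. Qed.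

Lemma tnorm_ge0 q u : 0 <= tnorm q u.
Proof. exact: sqrtr_ge0. Qed.

Lemma tnorm0 q : tnorm q 0 = 0.
Proof. by rewrite /tnorm tinner0r sqrtr0. Qed.

Lemma tnorm_eq0 q u : tnorm q u = 0 -> u = 0.
Proof.
move=> h; apply/eqP; apply: contraT => u0.
by have := @gmetric_posdef _ _ M q u u0; rewrite -sqr_tnorm h expr0n ltxx.
Qed.

Lemma tnormZ q (a : R) u : 0 <= a -> tnorm q (a *: u) = a * tnorm q u.
Proof.
move=> a0; rewrite /tnorm tinnerZr tinnerC tinnerZr mulrA -expr2.
by rewrite sqrtrM ?sqr_ge0// sqrtr_sqr ger0_norm.
Qed.

(** Cauchy-Schwarz, from the nonnegativity of the square of <v, v> u - <u, v> v. *)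
Lemma tinner_le q u v : ginner q u v <= tnorm q u * tnorm q v.
Proof.
have [->|v0] := eqVneq v 0; first by rewrite tinner0r tnorm0 mulr0.
have vv : 0 < ginner q v v by exact: gmetric_posdef.
have h : 0 <= ginner q u u * ginner q v v - ginner q u v ^+ 2.
  have := tinner_ge0 q (ginner q v v *: u + (- ginner q u v) *: v).
  rewrite tinnerDr !tinnerZr ![ginner q (_ + _) _]tinnerC !tinnerDr !tinnerZr.
  rewrite [ginner q v u]tinnerC => h.
  rewrite -(pmulr_rge0 _ vv); apply: le_trans h _.
  rewrite le_eqVlt; apply/orP; left; apply/eqP; ring.
apply: le_trans (ler_norm _) _.
rewrite /tnorm -sqrtrM ?tinner_ge0// -sqrtr_sqr ler_wsqrtr//.
by rewrite -subr_ge0.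
Qed.

(** Formally (sqrt f)' <= C; since [f] may vanish, the mean value theorem is
    applied to sqrt (f + e^2), whose value at 0 is [e], and then [e] tends to 0. *)
Lemma sqrt_growth (f df : R -> R) (C : R) : 0 <= C ->
  (forall t, 0 <= t <= 1 -> is_derive t 1 f (df t)) ->
  (forall t, 0 <= t <= 1 -> 0 <= f t) ->
  (forall t, 0 <= t <= 1 -> df t <= 2 * (Num.sqrt (f t) * C)) ->
  f 0 = 0 -> Num.sqrt (f 1) <= C.
Proof.
move=> C0 dff f0 dfle f00; apply/ler_addgt0Pr => e e0.
pose g t := Num.sqrt (f t + e ^+ 2).
pose dg t := (2 * g t)^-1 * df t.
have fe t : 0 <= t <= 1 -> 0 < f t + e ^+ 2.
  by move=> t01; rewrite ltr_wpDl ?f0// exprn_gt0.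
have dgg t : 0 <= t <= 1 -> is_derive t 1 g (dg t).
  move=> t01; have ds := is_derive1_sqrt (fe _ t01).
  have dh : is_derive t 1 (fun t => f t + e ^+ 2) (df t).
    rewrite -[df t]addr0; apply: is_deriveD; exact: dff.
  exact: (@is_derive1_comp R Num.sqrt (fun t => f t + e ^+ 2) t _ _ ds dh).
have dgo t : t \in `]0, 1[ -> is_derive t 1 g (dg t).
  by rewrite in_itv /= => /andP[t0 t1]; apply: dgg; rewrite !ltW.
have cg : {within `[0, 1], continuous g}.
  by apply: derivable_within_continuous => t; rewrite in_itv /= => /dgg[].
have [s s01] := MVT_segment ler01 dgo cg.
rewrite in_itv /= in s01; rewrite subr0 mulr1 => h.
have g0 : g 0 = e by rewrite /g f00 add0r sqrtr_sqr gtr0_norm.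
have dgC : dg s <= C.
  have gs : 0 < g s by rewrite sqrtr_gt0 fe.
  rewrite /dg mulrC ler_pdivrMr ?mulr_gt0//.
  apply: le_trans (dfle _ s01) _.
  have -> : C * (2 * g s) = 2 * (g s * C) by ring.
  by rewrite ler_wpM2l// ler_wpM2r// ler_wsqrtr// lerDl sqr_ge0.
apply: (@le_trans _ _ (g 1)); first by rewrite ler_wsqrtr// lerDl sqr_ge0.
by rewrite -lerBlDr -g0 h.
Qed.

Section Field.
Context (U : set M) (Y : M -> 'rV[R]_n) (Y_C1 : C1_field_on U Y).

Lemma field_rep_center q : field_rep Y q (chart q q) = Y q.
Proof.
have qq := chart_dom_center q.
by rewrite /field_rep param_chart// coord_change_id.
Qed.

Lemma field_rep_diff q : U q -> differentiable (field_rep Y q) (chart q q).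
Proof.
move=> Uq; have [V [oV UV YC]] := Y_C1; have [+ _] := YC q; apply.
rewrite inE; exists q => //; split; [exact: chart_dom_center|exact: UV].
Qed.

Lemma nablaZ q (a : R) v : U q -> nabla Y q (a *: v) = a *: nabla Y q v.
Proof.
move=> Uq; have d := field_rep_diff Uq.
rewrite /nabla !deriveE// linearZ christoffel_formC christoffel_formZr.
by rewrite christoffel_formC scalerDr.
Qed.

(** With X = Y - (1 - s) c', the covariant derivative is
    nabla_{c'} Y + c' - (1 - s) D c', and D c' = 0 for a geodesic. *)
Lemma is_derive_defect c t : geodesic_segment c -> t \in `[0, 1] -> U (c t) ->
  is_derive t 1
    (fun s => ginner (c s) (Y (c s) - (1 - s) *: velocity c s)
                           (Y (c s) - (1 - s) *: velocity c s))
    (2 * ginner (c t) (Y (c t) - (1 - t) *: velocity c t)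
           (nabla Y (c t) (velocity c t) + velocity c t)).
Proof.
move=> gc t01 Ut; have cg := geodesic_at_segment gc t01.
have [ct gt] := nbhs_singleton cg.
have pt := chart_dom_center (c t); have [dx ddx eq0] := gt _ pt.
set p := c t in pt dx ddx eq0 *; pose x := chart p \o c.
have vx : is_derive t 1 x (velocity c t).
  by rewrite /velocity derive1E; exact: (derivableP dx).
have vv : is_derive t 1 (derive1 x) (derive1 (derive1 x) t).
  by rewrite [X in is_derive _ _ _ X]derive1E; exact: derivableP.
have dY : is_derive t 1 (field_rep Y p \o x) ('D_(velocity c t) (field_rep Y p) (chart p p)).
  by apply: is_derive_curve => //; exact: field_rep_diff.
pose xi s := field_rep Y p (x s) - (1 - s) *: derive1 x s.
pose dxi := 'D_(velocity c t) (field_rep Y p) (chart p p) -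
  ((1 - t) *: derive1 (derive1 x) t - derive1 x t).
have Dxi : is_derive t 1 xi dxi.
  apply: is_deriveB.
  apply: is_derive_coordP => i j.
  have -> : (fun s => ((1 - s) *: derive1 x s) i j) = (fun s => (1 - s) * derive1 x s i j).
    by apply/funext => s; rewrite mxE.
  have d1 : is_derive t 1 (fun s : R => 1 - s) (-1).
    by rewrite -[-1]add0r; apply: is_deriveB.
  have dm := is_derive_mul d1 (is_derive_coord i j vv).
  apply: (is_derive_eq dm); rewrite !mxE; ring.
(* [xi] represents the field in the chart at [p], including at the nearby
   points, where vectors are coordinatized by the charts at those points. *)
have nX : \forall s \near t, Y (c s) - (1 - s) *: velocity c s =
    coord_change p (c s) (c s) (xi s).
  have nv := geodesic_velocity_near cg pt.
  have np := curve_near_dom ct pt.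
  near=> s; have ps : chart_dom p (c s) by near: s.
  have cs := chart_dom_center (c s).
  have -> : velocity c s = coord_change p (c s) (c s) (derive1 (chart p \o c) s).
    by near: s.
  rewrite /xi coord_changeB coord_changeZ /field_rep /x /= param_chart//.
  by rewrite coord_change_comp// coord_change_id.
apply: (is_derive_eq (is_derive_tinner_along ct pt vx Dxi nX)).
congr (2 * ginner _ _ _); rewrite coord_change_id// -/p.
have -> : xi t = Y p - (1 - t) *: velocity c t.
  by rewrite /xi /x /= field_rep_center.
have ev : derive1 x t = velocity c t by [].
have ea : derive1 (derive1 x) t =
    - christoffel_form p (chart p p) (velocity c t) (velocity c t).
  by apply/eqP; rewrite -addr_eq0; apply/eqP; exact: eq0.
rewrite /dxi ev ea /nabla -scaleNr christoffel_formDr christoffel_formZr.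
apply/rowP => i; rewrite !mxE; ring.
Unshelve. all: by end_near. Qed.

(** The choice of the initial velocity makes Y - (1 - s) c' vanish at 0, while its
    value at 1 is the value of [Y] at the end point. *)
Lemma field_growth c (C : R) : geodesic_segment c -> 0 <= C ->
  {in `[0, 1], forall t, U (c t)} -> velocity c 0 = Y (c 0) ->
  {in `[0, 1], forall t, tnorm (c t)
     (nabla Y (c t) (velocity c t) + velocity c t) <= C} ->
  tnorm (c 1) (Y (c 1)) <= C.
Proof.
move=> gc C0 cU v0 nC.
pose X s := Y (c s) - (1 - s) *: velocity c s.
have X1 : X 1 = Y (c 1) by rewrite /X subrr scale0r subr0.
have X0 : X 0 = 0 by rewrite /X subr0 scale1r v0 subrr.
rewrite -X1 /tnorm.
apply: (@sqrt_growth (fun s => ginner (c s) (X s) (X s))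
  (fun t => 2 * ginner (c t) (X t) (nabla Y (c t) (velocity c t) + velocity c t))) => //.
- move=> t t01; have t01' : t \in `[0, 1] by rewrite in_itv.
  by apply: is_derive_defect => //; exact: cU.
- by move=> t _; exact: tinner_ge0.
- move=> t t01; have t01' : t \in `[0, 1] by rewrite in_itv.
  rewrite ler_wpM2l//; apply: le_trans (tinner_le _ _ _) _.
  by rewrite ler_wpM2l ?tnorm_ge0// nC.
- by rewrite X0 tinner0r.
Qed.

End Field.

Lemma inj_radius_injective p (r : R) : (r%:E < inj_radius p)%E ->
  exists2 rho, r < rho &
    tball p rho `<=` exp_defined p /\ {in tball p rho &, injective (Exp p)}.
Proof.
move=> /ereal_sup_gt[_ [rho [rho0 rexp [_ _ _ [h hK _]]] <-]].
rewrite lte_fin => rrho; exists rho => //; split => //.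
exact: can_in_inj hK.
Qed.

(** The operator norm only tests vectors of norm at most 1, hence the scaling;
    [nablaZ] applies because [Y] is differentiable at the points of [U]. *)
Lemma nabla_add_opnorm U (Y : M -> 'rV[R]_n) q v (K : R) : C1_field_on U Y -> U q ->
  (opnorm q (fun v => (nabla Y q v + v)%R) <= K%:E)%E ->
  tnorm q (nabla Y q v + v) <= K * tnorm q v.
Proof.
move=> YC Uq HK.
have [->|v0] := eqVneq v 0.
  have -> : nabla Y q 0 = 0 by rewrite -[X in nabla _ _ X](scale0r 0) (nablaZ YC)// scale0r.
  by rewrite addr0 tnorm0 mulr0.
have nv : 0 < tnorm q v.
  rewrite lt_def tnorm_ge0 andbT; apply: contra_neq v0; exact: tnorm_eq0.
pose w := (tnorm q v)^-1 *: v.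
have w1 : tnorm q w <= 1.
  by rewrite tnormZ ?invr_ge0 ?tnorm_ge0// mulVf// gt_eqF.
have vw : v = tnorm q v *: w by rewrite scalerA divff ?scale1r// gt_eqF.
have : tnorm q (nabla Y q w + w) <= K.
  by rewrite -lee_fin; apply: le_trans HK; apply: ereal_sup_ubound; exists w.
move=> h; rewrite {1 2}vw (nablaZ YC)// -scalerDr tnormZ ?tnorm_ge0//.
by rewrite mulrC ler_wpM2r ?tnorm_ge0.
Qed.

End Estimate.

Theorem proposition5p1 (R : realType) (n : nat) (M : riemannianManifold R n)
    (M_connected : connected [set: M])
    (U : set M) (U_convex : geodesically_convex U)
    (Y : M -> 'rV[R]_n) (Y_C1 : C1_field_on U Y)
    (eps0 : R)
    (Y_bound : forall p, U p -> tnorm p (Y p) <= eps0)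
    (eps0_lt : (eps0%:E < inj_radius_set U)%E)
    (U_stable : forall p, U p -> U (Psi Y p))
    (p0 : M) (Up0 : U p0) (m : nat) (m_ge1 : (1 <= m)%N) :
  (rdist (iter m.+1 (Psi Y) p0) (iter m (Psi Y) p0) <=
   ereal_sup [set opnorm p (fun v => (nabla Y p v + v)%R) | p in U] *
   rdist (iter m (Psi Y) p0) (iter m.-1 (Psi Y) p0))%E.
Proof.
case: m m_ge1 => // m _; rewrite [m.+1.-1]/= [iter m.+2 _ _]iterS [iter m.+1 _ _]iterS.
set p := iter m _ _; set q := Psi Y p.
have Up : U p by rewrite /p; elim: m @p @q => //= m IH; exact: U_stable.
have Uq : U q by exact: U_stable.
have inj r : U r -> exists2 rho, eps0 < rho &
    tball r rho `<=` exp_defined r /\ {in tball r rho &, injective (Exp r)}.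
  move=> Ur; apply: inj_radius_injective; apply: lt_le_trans eps0_lt _.
  by apply: ereal_inf_lbound; exists r.
have dle r : U r -> (rdist (Psi Y r) r <= (tnorm r (Y r))%:E)%E.
  move=> Ur; have [rho erho [rexp _]] := inj r Ur.
  have [c gc] : exp_defined r (Y r).
    by apply: rexp; rewrite /tball /=; exact: le_lt_trans (Y_bound _ Ur) erho.
  rewrite /Psi (Exp_geodesic gc); have [cg c0 cv] := gc.
  by have := rdist_reverse_le cg; rewrite cv c0.
have [c' [[gc' c'0 c'1 lc'] _ c'U]] := U_convex q p Uq Up.
pose c := reverse c'.
have gc : geodesic_segment c by exact: reverse_geodesic.
have c0 : c 0 = p by rewrite /c /reverse subr0.
have c1 : c 1 = q by rewrite /c /reverse subrr.
have cU : {in `[0, 1], forall t, U (c t)}.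
  move=> t; rewrite in_itv /= => /andP[t0 t1]; apply: c'U.
  by rewrite in_itv /= subr_ge0 t1 lerBlDr lerDl.
pose w := velocity c 0.
have wd : rdist q p = (tnorm p w)%:E.
  have s1 : tnorm (c 0) w = tnorm (c' 0) (velocity c' 0) := reverse_speed gc'.
  by rewrite -lc' (geodesic_length gc') -s1 c0.
(* Injectivity of exp_p identifies the minimal geodesic with the radial one. *)
have wY : w = Y p.
  have [rho erho [_ einj]] := inj p Up.
  have Yrho : tnorm p (Y p) < rho by exact: le_lt_trans (Y_bound _ Up) erho.
  apply: einj; rewrite ?inE /tball //=.
    by apply: le_lt_trans Yrho; rewrite -lee_fin -wd; exact: dle.
  by rewrite (@Exp_geodesic _ _ _ p w c)// c1.
rewrite wd wY; apply: le_trans (dle q Uq) _.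
set k := ereal_sup _.
have speed t : t \in `[0, 1] -> tnorm (c t) (velocity c t) = tnorm p (Y p).
  have [e e0 cg] := gc => t01.
  by rewrite (geodesic_speed e0 cg t01) c0 -/w wY.
have k0 : (0 <= k)%E.
  apply: (@le_trans _ _ (opnorm p (fun v => (nabla Y p v + v)%R))).
    apply: (@le_trans _ _ (tnorm p (nabla Y p 0 + 0))%:E); first by rewrite lee_fin tnorm_ge0.
    by apply: ereal_sup_ubound; exists 0 => //=; rewrite tnorm0.
  by apply: ereal_sup_ubound; exists p.
have growth (K : R) : 0 <= K ->
    (forall t v, t \in `[0, 1] -> tnorm (c t) v = tnorm p (Y p) ->
      tnorm (c t) (nabla Y (c t) v + v) <= K) -> tnorm q (Y q) <= K.
  move=> K0 HK; rewrite -c1; apply: (field_growth Y_C1 gc) => //.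
    by rewrite c0 -wY.
  by move=> t t01; apply: HK => //; exact: speed.
(* Apart, because the supremum may be infinite, and then 0 * +oo = 0. *)
have [Y0|Yp0] := eqVneq (tnorm p (Y p)) 0.
  rewrite Y0 mule0 lee_fin; apply: growth => // t v t01; rewrite Y0 => /tnorm_eq0 ->.
  have -> : nabla Y (c t) 0 = 0.
    by rewrite -[X in nabla _ _ X](scale0r 0) (nablaZ Y_C1) ?scale0r//; exact: cU.
  by rewrite addr0 tnorm0.
have Ypos : 0 < tnorm p (Y p) by rewrite lt_def Yp0 tnorm_ge0.
have kle r : U r -> (opnorm r (fun v => (nabla Y r v + v)%R) <= k)%E.
  by move=> Ur; apply: ereal_sup_ubound; exists r.
move: k k0 kle => [K||] // K0 kle; last by rewrite gt0_mulye ?lte_fin// leey.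
rewrite -EFinM lee_fin; apply: growth; first by rewrite mulr_ge0 ?tnorm_ge0// -lee_fin.
move=> t v t01 <-; apply: (nabla_add_opnorm v Y_C1); first exact: cU.
by apply: kle; exact: cU.
Qed.
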